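(* Let $R$ be a uniserial ring. Every point of $\mathrm{Zg}_R$ is topologically indistinguishable from an indecomposable pure-injective module of one of the following forms: (1) $N(P,K)$, where $K$ is a (proper) two-sided ideal, $P$ is a completely prime two-sided ideal, and for all $r,s\in R$, $rs\in K$ implies $r\in K$ or $s\in P$; (2) $N(K,P)$, where $K$ is a (proper) two-sided ideal, $P$ is a completely prime two-sided ideal, and for all $r,s\in R$, $sr\in K$ implies $r\in K$ or $s\in P$; (3) $N(I_b^P,{}_a^{Q}I)$, where $P,Q$ are non-zero completely prime two-sided ideals, $0\neq b\in P$, $0\neq a\in Q$, and the pair $\langle I_b^P,{}_a^{Q}I\rangle$ is consistent.
   Context: A ring is uniserial if its right ideals are totally ordered by inclusion and its left ideals are totally ordered by inclusion. Modules are right modules. A (proper) ideal $P$ is completely prime if $xy\in P$ implies $x\in P$ or $y\in P$. A pp-$n$-formula is a formula $\exists\bar y\,(\bar y,\bar x)A=0$ with $A$ a matrix over $R$; $\varphi(M)$ is its solution set in $M$; $s|x$ abbreviates $\exists y\;x=ys$. A module $N$ is pure-injective if every pure-embedding (embedding reflecting solution sets of pp-formulae) out of $N$ splits. $\mathrm{Zg}_R$ is the space of isomorphism classes of indecomposable pure-injective right $R$-modules, with basis of open sets $(\varphi/\psi)=\{N:\varphi(N)\supsetneq\varphi(N)\cap\psi(N)\}$ for pp-$1$-formulae $\varphi,\psi$. Two points are topologically indistinguishable if they lie in the same open sets. A pair is $\langle I,J\rangle$ with $I$ a proper right ideal and $J$ a proper left ideal of $R$. Put $J^*/I:=\{s|x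 : s\notin J\}\cup\{xr=0 : r\in I\}\cup\{\neg(sr|xr) : s\in J, r\notin I\}$. The pair is consistent if $J^*/I$ is satisfied by some element of some $R$-module. In that case it is known that, up to isomorphism, there is a unique indecomposable pure-injective module containing an element satisfying $J^*/I$; it is denoted $N(I,J)$. (Pairs satisfying the conditions in (1) and (2) are consistent.) For a non-zero completely prime two-sided ideal $P$ and $0\ne b\in P$: $I_b^P:=\{c\in R : b\notin cP\}$ (a right ideal) and ${}_b^{P}I:=\{c\in R : b\notin Pc\}$ (a left ideal). *)

(* Defs.v *)
From HB Require Import structures.
From mathcomp Require Import all_boot all_order all_algebra.
From mathcomp Require Import boolp classical_sets.

Set Implicit Arguments.
Unset Strict Implicit.
Unset Printing Implicit Defensive.

Import GRing.Theory.
Local Open Scope ring_scope.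
Local Open Scope classical_set_scope.

(* Rings are associative and unital, not assumed commutative or non-trivial;
   ideals are arbitrary (not necessarily decidable) subsets. *)

Section Ideals.
Variable R : pzRingType.
Implicit Types I J P K : set R.

Definition additive_subgroup I : Prop :=
  I 0 /\ (forall x y, I x -> I y -> I (x - y)).

Definition right_ideal I : Prop :=
  additive_subgroup I /\ (forall x r, I x -> I (x * r)).

Definition left_ideal I : Prop :=
  additive_subgroup I /\ (forall r x, I x -> I (r * x)).

Definition two_sided_ideal I : Prop := right_ideal I /\ left_ideal I.

Definition is_proper I : Prop := I <> [set: R].

Definition nonzero_ideal I : Prop := I <> [set 0].

Definition uniserial : Prop :=
  (forall I J, right_ideal I -> right_ideal J -> I `<=` J \/ J `<=` I) /\
  (forall I J, left_ideal I -> left_ideal J -> I `<=` J \/ J `<=` I).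

Definition completely_prime P : Prop :=
  [/\ two_sided_ideal P, is_proper P & forall x y, P (x * y) -> P x \/ P y].

(* {c | b \notin cP} and {c | b \notin Pc} *)
Definition right_Ib P (b : R) : set R :=
  [set c | ~ exists2 p, P p & b = c * p].

Definition left_Ib P (b : R) : set R :=
  [set c | ~ exists2 p, P p & b = p * c].

End Ideals.

(* A right R-module is a left module over the converse ring. *)
Notation rmodType R := (lmodType (GRing.converse R)).

Definition ract (R : pzRingType) (M : rmodType R) (x : M) (r : R) : M :=
  (r : GRing.converse R) *: x.

Section Modules.
Variable R : pzRingType.
Implicit Types M N : rmodType R.

(* The formula "exists y, (y, x) A = 0" with n free variables x; the first
   pp_bound rows of A correspond to y. *)
Record pp_formula (n : nat) := PPFormula {
  pp_bound : nat;
  pp_eqs : nat;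
  pp_matrix : 'M[R]_(pp_bound + n, pp_eqs)
}.

Definition pp_sol n (phi : pp_formula n) M : set ('I_n -> M) :=
  [set x | exists y : 'I_(pp_bound phi) -> M, forall j : 'I_(pp_eqs phi),
     \sum_(i < pp_bound phi) ract (y i) (pp_matrix phi (lshift n i) j) +
     \sum_(k < n) ract (x k) (pp_matrix phi (rshift (pp_bound phi) k) j) = 0].

Definition pure_embedding N M (f : {linear N -> M}) : Prop :=
  injective f /\
  forall n (phi : pp_formula n) (x : 'I_n -> N),
    pp_sol phi (f \o x) -> pp_sol phi x.

Definition pure_injective N : Prop :=
  forall M (f : {linear N -> M}), pure_embedding f ->
    exists g : {linear M -> N}, cancel f g.

Definition mod_iso M N : Prop := exists f : {linear M -> N}, bijective f.

Definition trivial_mod M : Prop := forall x : M, x = 0.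

Definition indecomposable N : Prop :=
  ~ trivial_mod N /\
  forall A B : rmodType R, mod_iso N (A * B)%type ->
    trivial_mod A \/ trivial_mod B.

(* Points are isomorphism classes.  Classes of modules are plain predicates
   rather than terms of type set, which avoids universe constraints between
   set and lmodType. *)
Record Zg := ZgPoint {
  zg_class :> rmodType R -> Prop;
  zg_classP : exists N, [/\ indecomposable N, pure_injective N &
                            zg_class = mod_iso N]
}.

Definition zg_basic (phi psi : pp_formula 1) (p : Zg) : Prop :=
  exists2 N, p N & (@pp_sol 1 phi N `&` @pp_sol 1 psi N) `<` @pp_sol 1 phi N.

Definition zg_open (U : Zg -> Prop) : Prop :=
  forall p, U p -> exists phi psi : pp_formula 1,
    zg_basic phi psi p /\ forall q, zg_basic phi psi q -> U q.

Definition indistinguishable (p q : Zg) : Prop :=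
  forall U, zg_open U -> (U p <-> U q).

Definition divides (s : R) M (x : M) : Prop := exists y : M, x = ract y s.

Definition is_pair (I J : set R) : Prop :=
  [/\ right_ideal I, is_proper I, left_ideal J & is_proper J].

(* x satisfies J^*/I *)
Definition satisfies (I J : set R) M (x : M) : Prop :=
  [/\ forall s, ~ J s -> divides s x,
      forall r, I r -> ract x r = 0 &
      forall s r, J s -> ~ I r -> ~ divides (s * r) (ract x r)].

Definition consistent (I J : set R) : Prop :=
  is_pair I J /\ exists M (x : M), satisfies I J x.

(* p is the point N(I,J): since the indecomposable pure-injective module with
   an element satisfying J^*/I is unique up to isomorphism, having such an
   element identifies it. *)
Definition is_N (I J : set R) (p : Zg) : Prop :=
  is_pair I J /\ exists2 N, p N & exists x : N, satisfies I J x.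

End Modules.

(* Main.v *)
(* Write [B(t, g)] for "some y in N has t not dividing y and yg = 0", and let
   P, Q, A be the sets of ring elements that kill a nonzero element of N, that
   fail to divide some element of N, and that annihilate N.

   Over a uniserial ring every pp-formula is equivalent to a conjunction of
   divisibilities d | (linear form): variables are eliminated one at a time,
   and the compatibility of the resulting cosets of subgroups M k + ann a is a
   Chinese remainder argument in the distributive lattice generated by two
   chains.  So the pp-type of an element x of an indecomposable pure-injective
   N is given by its annihilator and its set of non-divisors, and two nonzero
   elements x, z are linked: z has the type of some x k or x that of some z k.
   Both facts come from one statement: an endomorphism of N fixing a nonzero
   element is bijective.

   Besides sums, types admit "joins" (divide x by 1 + e), and with both
   operations the open sets containing N are determined by A and B alone.
   - If B(t, g) holds with N tg <> 0, the pair (I_g^P, _t^Q I) is finitely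
     satisfied in N and its realization has the same A and B as N.
   - Otherwise, up to symmetry, every s in Q has sc in A for some c outside A.
     Then N(P, A) has the same A and B as N unless some B(t, g) is not witnessed
     by a factorization g = cp with tc in A, c outside A and p in P; in that
     case N itself is N(I_g^P, _t^Q I).

   Pure-injectives are handled through algebraic compactness, which holds for
   the bidual Hom_Z(Hom_Z(M, Q/Z), Q/Z). *)

Require Import Defs.
From HB Require Import structures.
From mathcomp Require Import all_boot all_order all_algebra.
From mathcomp Require Import boolp classical_sets functions.

Set Implicit Arguments.
Unset Strict Implicit.
Unset Printing Implicit Defensive.

Import GRing.Theory Num.Theory.
Local Open Scope ring_scope.

Local Notation "x <* r" := (ract x r) (at level 40, left associativity).

(** * Modules over uniserial rings *)

Section RightAction.
Variables (R : pzRingType) (M : rmodType R).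
Implicit Types (x y : M) (r s t : R).

(** By the chain conditions, finitely many conditions [s | x], [x r <> 0], [t] not dividing [x],
    [x b = 0] reduce to one of each kind. The obstacle is that a module may offer elements meeting
    some of the four and none that visibly meets all. Sums alone do not combine such elements; joins
    do, because at least one of [k], [1 + k] is a unit.

    That an endomorphism fixing a nonzero element is bijective comes from a summand around this
    element: compactness yields a maximal set that is rigid over the element and a maximal
    endomorphism fixing that set; it is idempotent, and indecomposability makes it the identity.

    The pair (I_g^P, _t^Q I) is the right one because it remembers P and Q: each [r] in P takes some
    [c] outside I_g^P to [c r] inside, so [r] kills a nonzero multiple of the realizing element;
    dually for Q.

    The bidual is formed relative to a submodule. The zero submodule serves to show that
    pure-injectives are algebraically compact; the eventually vanishing functions in a power of N
    serve to realize a finitely satisfied pair. *)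

Lemma ractM x r s : x <* (r * s) = x <* r <* s.
Proof. by rewrite /ract scalerA. Qed.

Lemma ractDl x r s : x <* (r + s) = x <* r + x <* s.
Proof. exact: scalerDl. Qed.

Lemma ractN x r : x <* (- r) = - (x <* r).
Proof. exact: scaleNr. Qed.

Lemma ract1 x : x <* 1 = x.
Proof. exact: scale1r. Qed.

Lemma ract0 x : x <* 0 = 0.
Proof. exact: scale0r. Qed.

Lemma ract0l r : (0 : M) <* r = 0.
Proof. exact: scaler0. Qed.

Lemma ractDr x y r : (x + y) <* r = x <* r + y <* r.
Proof. exact: scalerDr. Qed.

Lemma ractNl x r : (- x) <* r = - (x <* r).
Proof. exact: scalerN. Qed.

Lemma ractBr x y r : (x - y) <* r = x <* r - y <* r.
Proof. by rewrite ractDr ractNl. Qed.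

Lemma ract_suml (I : Type) (l : seq I) (P : pred I) (F : I -> M) r :
  (\sum_(i <- l | P i) F i) <* r = \sum_(i <- l | P i) F i <* r.
Proof. exact: scaler_sumr. Qed.

Lemma ract_sumr (I : Type) (l : seq I) (P : pred I) (F : I -> R) x :
  x <* (\sum_(i <- l | P i) F i) = \sum_(i <- l | P i) x <* F i.
Proof.
by elim/big_rec2: _ => [|i a b _ <-]; rewrite ?ract0 // ractDl.
Qed.

Lemma ract_neq0 x r : x <* r <> 0 -> x <> 0.
Proof. by move=> h x0; apply: h; rewrite x0 ract0l. Qed.

Lemma div1 x : divides 1 x.
Proof. by exists x; rewrite ract1. Qed.

Lemma div0 x : divides 0 x <-> x = 0.
Proof. by split=> [[y ->]|->]; [rewrite ract0 | exists 0; rewrite ract0]. Qed.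

Lemma div_zero s : divides s (0 : M).
Proof. by exists 0; rewrite ract0l. Qed.

Lemma divMl r s x : divides (r * s) x -> divides s x.
Proof. by case=> y ->; exists (y <* r); rewrite ractM. Qed.

Lemma divMr s r x : divides s x -> divides (s * r) (x <* r).
Proof. by case=> y ->; exists y; rewrite ractM. Qed.

Lemma divD s x y : divides s x -> divides s y -> divides s (x + y).
Proof. by case=> a -> [b ->]; exists (a + b); rewrite ractDr. Qed.

Lemma divN s x : divides s x -> divides s (- x).
Proof. by case=> a ->; exists (- a); rewrite ractNl. Qed.

Lemma divB s x y : divides s x -> divides s y -> divides s (x - y).
Proof. by move=> ? ?; apply/divD/divN. Qed.

End RightAction.

(** * Chains of one-sided ideals and local structure *)

Section Uniserial.
Variables (R : pzRingType) (hR : uniserial R).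
Implicit Types (r s t a b k : R).

Lemma right_chain a b : (exists k, a = b * k) \/ (exists k, b = a * k).
Proof.
have rid c : right_ideal [set x : R | exists k, x = c * k]%classic.
  split; last by move=> x r [k ->]; exists (k * r); rewrite mulrA.
  split; first by exists 0; rewrite mulr0.
  by move=> x y [k ->] [l ->]; exists (k - l); rewrite mulrBr.
by case: (hR.1 _ _ (rid a) (rid b)) => h; [left|right]; apply: h => /=;
  exists 1; rewrite mulr1.
Qed.

Lemma left_chain a b : (exists k, a = k * b) \/ (exists k, b = k * a).
Proof.
have lid c : left_ideal [set x : R | exists k, x = k * c]%classic.
  split; last by move=> r x [k ->]; exists (r * k); rewrite mulrA.
  split; first by exists 0; rewrite mul0r.
  by move=> x y [k ->] [l ->]; exists (k - l); rewrite mulrBl.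
by case: (hR.2 _ _ (lid a) (lid b)) => h; [left|right]; apply: h => /=;
  exists 1; rewrite mul1r.
Qed.

Definition inverses a u := a * u = 1 /\ u * a = 1.

(** The idempotent [b * a] and its complement are comparable as right ideals, so one of the two
    vanishes; if it is [b * a], the ring is trivial. *)
Lemma right_inverse a b : a * b = 1 -> b * a = 1.
Proof.
move=> ab1; have ee : b * a * (b * a) = b * a.
  by rewrite mulrA -(mulrA b) ab1 mulr1.
case: (right_chain (b * a) (1 - b * a)) => [] [k E].
  have e0 : b * a = 0 by rewrite -ee {2}E mulrA mulrBr mulr1 ee subrr mul0r.
  have : (1 : R) = 0.
    by rewrite -ab1 -[a]mul1r -{1}ab1 -(mulrA a) e0 mulr0 mul0r.
  by move=> z; rewrite -[LHS]mulr1 z mulr0.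
have h : (1 - b * a) * (1 - b * a) = 0.
  by rewrite {2}E mulrA mulrBl mul1r ee subrr mul0r.
have {}h : 1 - b * a = 0.
  by rewrite -h mulrBr mulr1 mulrBl mul1r ee subrr subr0.
by move/eqP: h; rewrite subr_eq0 => /eqP <-.
Qed.

(** Comparing the right ideals of [a] and [1 + a] gives a one-sided inverse of one of them. *)
Lemma local_ring a : (exists u, inverses a u) \/ (exists u, inverses (1 + a) u).
Proof.
case: (right_chain (1 + a) a) => [] [k E].
  left; exists (k - 1).
  have h : a * (k - 1) = 1 by rewrite mulrBr -E mulr1 addrK.
  by split=> //; exact: right_inverse.
right; exists (1 - k).
have h : (1 + a) * (1 - k) = 1 by rewrite mulrBr -E mulr1 addrK.
by split=> //; exact: right_inverse.
Qed.

Section UniserialModules.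
Variable M : rmodType R.
Implicit Types (x y z w : M).

Lemma ann_cmp x b r : x <* b = 0 -> x <* r <> 0 -> exists k, b = r * k.
Proof.
move=> xb xr; case: (right_chain b r) => // -[k E].
by case: xr; rewrite E ractM xb ract0l.
Qed.

Lemma div_cmp x t d : ~ divides t x -> divides d x -> exists k, t = k * d.
Proof.
move=> nt dx; case: (left_chain t d) => // -[k E].
by case: nt; apply: (@divMl _ _ k); rewrite -E.
Qed.

Lemma ndivD x s t : ~ divides s x -> ~ divides t x -> ~ divides (s + t) x.
Proof.
move=> ns nt; case: (left_chain s t) => -[k E]; move: ns nt; rewrite E => ns nt.
  by rewrite -{2}[t]mul1r -mulrDl => /divMl.
by rewrite -{1}[s]mul1r -mulrDl => /divMl.
Qed.

(** [divides (s * r) (x <* r)] says that [x] lies in M s + ann r. So this is irreducibility of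
    types: an element of such a sum lies in one of the summands. *)
Definition pp_irreducible := forall x s r,
  divides (s * r) (x <* r) -> divides s x \/ x <* r = 0.

(* Over a uniserial ring this is equality of pp-types when [pp_irreducible] holds. *)
Definition same_type x y :=
  (forall r, x <* r = 0 <-> y <* r = 0) /\
  (forall s, divides s x <-> divides s y).

Definition linked := forall x y, x <> 0 -> y <> 0 ->
  exists k, same_type y (x <* k) \/ same_type x (y <* k).

End UniserialModules.
End Uniserial.

(** * Dividing an element by 1 + e *)

Section Absorb.
Variables (R : pzRingType) (hR : uniserial R) (M : rmodType R).
Variables (x x' : M) (e : R).
Hypothesis xE : x = x' + x' <* e.

Lemma absorb_neq0 r : x <* r <> 0 -> x <* e <* r <> 0 -> x' <* e <* r <> 0.
Proof.
move=> xr xer z; case: (right_chain hR (e * r) r) => -[k E].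
  apply: xer; rewrite -ractM xE ractDr [x' <* (e * r)]ractM z add0r.
  by rewrite E ractM z ract0l.
apply: xr; rewrite xE ractDr z addr0.
by rewrite E ractM ractM z ract0l.
Qed.

(** Either [b = e b k] or [e b = b k]. If [k] were a unit, [b] would kill both or neither of [x] and
    [x e]; hence [1 + k] is a unit, and it kills [x' e b]. *)
Lemma absorb_eq0 b :
    x <* b = 0 /\ x <* e <* b <> 0 \/ x <* b <> 0 /\ x <* e <* b = 0 ->
  x' <* e <* b = 0.
Proof.
have unitK (m : M) k : m <* (1 + k) = 0 -> (exists u, inverses (1 + k) u) ->
    m = 0.
  by move=> mk [u [ku _]]; rewrite -[m]ract1 -ku ractM mk ract0l.
case=> -[xb xeb].
  have [k E] : exists k, b = e * b * k.
    case: (right_chain hR b (e * b)) => // -[k E].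
    by case: xeb; rewrite -ractM E ractM xb ract0l.
  case: (local_ring hR k) => [[u [ku _]]|]; last first.
    apply: unitK; rewrite ractDl ract1 -(ractM x' e b) -(ractM _ (e * b) k) -E.
    by rewrite addrC (ractM x' e b) -ractDr -xE.
  case: xeb; have -> : x <* e <* b = x <* b <* u.
    by rewrite {2}E -2!ractM -mulrA ku mulr1.
  by rewrite xb ract0l.
have [k E] : exists k, e * b = b * k.
  case: (right_chain hR (e * b) b) => // -[k E].
  by case: xb; rewrite E ractM ractM xeb ract0l.
case: (local_ring hR k) => [[u [ku _]]|]; last first.
  apply: unitK; rewrite ractDl ract1 -(ractM _ b k) -E -xeb xE !ractDr.
  by rewrite (ractM _ e b).
case: xb; have -> : b = e * b * u by rewrite E -mulrA ku mulr1.
by rewrite ractM ractM xeb ract0l.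
Qed.

Hypothesis irrM : pp_irreducible M.

(** With [t = k e], irreducibility turns [t | x' e] into [x' = y k]. Then [x = y (k + t)], although
    neither [k] nor [t] divides [x]. *)
Lemma absorb_ndiv t : ~ divides t x -> ~ divides t (x <* e) ->
  x' <* e <> 0 -> ~ divides t (x' <* e).
Proof.
move=> tx txe x'e.
case: (left_chain hR t e) => -[k tE]; last first.
  by case: txe; exists (x <* k); rewrite tE ractM.
rewrite tE => /irrM [|//] [y yE]; apply: (ndivD hR (x := x) (s := k) (t := t)).
- by rewrite tE in txe => kx; exact/txe/divMr.
- exact: tx.
by exists y; rewrite xE {1 2}yE ractDl tE ractM.
Qed.

End Absorb.

(** * The sets A, P, Q and the relation B of a module *)

Section Spectra.
Variables (R : pzRingType) (M : rmodType R).

Definition annih : set R := [set s | forall x : M, x <* s = 0]%classic.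

Definition torsion : set R := [set r | exists2 x : M, x <> 0 & x <* r = 0]%classic.

Definition nondiv : set R := [set s | exists x : M, ~ divides s x]%classic.

Definition covers t g := exists y : M, ~ divides t y /\ y <* g = 0.

End Spectra.

(** * Combining witnesses by joins and sums *)

Section GoodModules.
Variables (R : pzRingType) (hR : uniserial R) (M : rmodType R).
Hypothesis irrM : pp_irreducible M.

Lemma div_cancel s k (x : M) : x <* k <> 0 -> divides (s * k) (x <* k) ->
  divides s x.
Proof. by move=> xk /irrM []. Qed.

Lemma div_addr s t (x : M) : divides s x -> ~ divides t x -> divides (s + t) x.
Proof.
move=> sx tx; apply: contrapT => stx.
suff : ~ divides (s + t + - t) x by rewrite addrK.
apply: (ndivD hR stx) => -[y yE]; apply: tx.
by exists (- y); rewrite ractNl -ractN.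
Qed.

(** The witness is [x' e] for a suitable solution of [x = x' (1 + e)]. With [x' = x'' v] it is
    enough that [v + v e] divides [x] and [d] divides multiples of [v e]. In each case [v] is chosen
    so that exactly one of [v], [v e] divides [x]; their sum then divides [x] by [div_addr]. *)
Let join_shift (x : M) e b d r t :
    x <* r <> 0 -> x <* e <* r <> 0 ->
    ~ divides t x -> ~ divides t (x <* e) ->
    x <* b = 0 /\ x <* e <* b <> 0 /\ divides d (x <* e) /\ ~ divides d x \/
    x <* b <> 0 /\ x <* e <* b = 0 /\ divides d x /\ ~ divides d (x <* e) ->
  exists y : M, [/\ y <* b = 0, y <* r <> 0, divides d y & ~ divides t y].
Proof.
move=> xr xer tx txe H.
suff [x' xE dx'] : exists2 x', x = x' + x' <* e & divides d (x' <* e).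
  have x'er := absorb_neq0 hR xE xr xer.
  exists (x' <* e); split=> //; last first.
    by apply: (absorb_ndiv hR xE irrM tx txe); exact: ract_neq0 x'er.
  by apply: (absorb_eq0 hR xE); case: H => [[? []]|[? []]]; [left|right].
have lift v : divides (v + v * e) x ->
    exists x'' : M, x = x'' <* v + x'' <* v <* e.
  by case=> x'' ->; exists x''; rewrite -ractM -ractDl.
case: H => [[_ [_ [dxe dx]]]|[_ [_ [dx dxe]]]].
  case: (left_chain hR d e) => -[v E].
    have vx : divides v x.
      by apply: (@div_cancel _ e); [exact: ract_neq0 xer | rewrite -E].
    have /lift [x'' x''E] : divides (v + v * e) x.
      by apply: div_addr; rewrite -?E.
    by exists (x'' <* v) => //; exists x''; rewrite E ractM.
  have /lift [x'' x''E] : divides (1 + 1 * e) x.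
    apply: div_addr; first exact: div1.
    by rewrite mul1r E => /divMl.
  by exists (x'' <* 1) => //; rewrite E ractM; exists (x'' <* 1 <* v).
have [v E] : exists v, d = v * e.
  by apply: (div_cmp hR dxe); exists x.
have vx : ~ divides v x by move=> vx; apply: dxe; rewrite E; exact: divMr.
have /lift [x'' x''E] : divides (v + v * e) x.
  by rewrite addrC; apply: div_addr; rewrite -?E.
by exists (x'' <* v) => //; exists x''; rewrite E ractM.
Qed.

Hypothesis linkM : linked M.

(* Sums realize the smaller annihilator and the larger set of non-divisors of two
   types; this is the opposite combination, obtained as [x' e] where
   [x = x' (1 + e)]. *)
Lemma join (w z : M) b r d t :
    w <* b = 0 -> w <* r <> 0 -> z <* r <> 0 ->
    divides d z -> ~ divides t w -> ~ divides t z ->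
  exists y : M, [/\ y <* b = 0, y <* r <> 0, divides d y & ~ divides t y].
Proof.
move=> wb wr zr dz tw tz.
have [zb|zb] := EM (z <* b = 0); first by exists z.
have [dw|dw] := EM (divides d w); first by exists w.
have [k [[kann kdiv]|[kann kdiv]]] := linkM (ract_neq0 wr) (ract_neq0 zr).
  apply: (join_shift (x := w) (e := k)) => //; first by move/kann.
    by move/kdiv.
  by left; split=> //; split; [move/kann | split=> //; exact/kdiv].
apply: (join_shift (x := z) (e := k)) => //; first by move/kann.
  by move/kdiv.
by right; split=> //; split; [exact/kann | split=> // /kdiv].
Qed.

(* The element is found by shifting the four given witnesses to a common base
   point and taking joins and a sum of them. *)
Lemma fit s r t b :
    ~ annih M (s * r) -> torsion M b -> nondiv M t -> covers M (t * s) (r * b) ->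
  exists y : M,
    [/\ divides s y, y <* r <> 0, ~ divides (t * s) y & y <* (r * b) = 0].
Proof.
move=> /existsNP [m msr] [w w0 wb] [n tn] [m3 [tsm3 m3rb]].
have msr0 : m <* s <* r <> 0 by rewrite -ractM.
have [y1 [y1b y10 [v1 v1E] _]] : exists y : M,
    [/\ y <* b = 0, y <* 1 <> 0, divides (s * r) y & ~ divides 0 y].
  apply: (join (w := w) (z := m <* (s * r))); rewrite ?ract1 ?div0 //.
  by exists m.
have [y2 ty2 y2sr] : exists2 y2 : M, ~ divides t y2 & y2 <* (s * r) <> 0.
  have [tm|tm] := EM (divides t m); last by exists m.
  have [nsr|nsr] := EM (n <* (s * r) = 0); last by exists n.
  exists (m + n); last by rewrite ractDr nsr addr0.
  by move=> /divB /(_ tm); rewrite addrAC subrr add0r.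
have tsy2 : ~ divides (t * s) (y2 <* s).
  by move/irrM => [//|y2s]; apply: y2sr; rewrite ractM y2s ract0l.
(* [u1] meets every requirement except perhaps [~ divides (t * s) u1], and [y4] below every one
   except perhaps [y4 <* r <> 0]. When both fall short, their sum meets all. *)
pose u1 := v1 <* s; have u1r : u1 <* r <> 0.
  by rewrite -ractM -v1E -[y1]ract1.
have u1rb : u1 <* (r * b) = 0 by rewrite /u1 -ractM mulrA ractM -v1E.
have [y4 [y4rb y40 sy4 tsy4]] : exists y : M,
    [/\ y <* (r * b) = 0, y <* 1 <> 0, divides s y & ~ divides (t * s) y].
  apply: (join (w := m3) (z := y2 <* s)); rewrite ?ract1 //.
  - by move=> m30; apply: tsm3; rewrite m30; exact: div_zero.
  - by move=> y2s; apply: y2sr; rewrite ractM y2s ract0l.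
  - by exists y2.
have [y4r|y4r] := EM (y4 <* r = 0); last by exists y4.
have [tsu1|tsu1] := EM (divides (t * s) u1); last first.
  by exists u1; split=> //; exists v1.
exists (u1 + y4); split.
- by apply: divD => //; exists v1.
- by rewrite ractDr y4r addr0.
- by move=> /divB /(_ tsu1); rewrite addrAC subrr add0r.
- by rewrite ractDr u1rb y4rb addr0.
Qed.

End GoodModules.

(** One parameter of each kind is enough: among finitely many conditions of one kind, the chain
    conditions make one imply the others. *)
Definition approx (R : pzRingType) (N M : rmodType R) (x : N) :=
  forall s r t b : R,
    divides s x -> x <* r <> 0 -> ~ divides t x -> x <* b = 0 ->
  exists y : M, [/\ divides s y, y <* r <> 0, ~ divides t y & y <* b = 0].

Section Approximation.
Variables (R : pzRingType) (hR : uniserial R) (N M : rmodType R).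
Hypotheses (irrM : pp_irreducible M).

(* Together with [approx_link]: the open sets containing a module depend only on
   its annihilator and on [covers]. *)
Lemma approx_of_covers (x : N) : linked M ->
    (forall s, annih M s -> annih N s) ->
    (forall r, torsion N r -> torsion M r) ->
    (forall s, nondiv N s -> nondiv M s) ->
    (forall t b, ~ divides t x -> x <* b = 0 -> covers M t b) ->
  approx M x.
Proof.
move=> linkM hA hP hQ hB s r t b sx xr tx xb.
have [t' tE] := div_cmp hR tx sx; have [b' bE] := ann_cmp hR xb xr.
case: sx => w wE; rewrite tE bE; apply: fit => //.
- by move=> /hA /(_ w); rewrite ractM -wE.
- apply: hP; exists (x <* r) => //; by rewrite -ractM -bE.
- by apply: hQ; exists w => tw; apply: tx; rewrite tE wE; exact: divMr.
- by rewrite -tE -bE; exact: hB.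
Qed.

(** Conditions on one of two linked elements translate into conditions on the other by multiplying
    or cancelling [k]. Where [k] cannot be cancelled from a parameter, it is the parameter that
    divides [k], and 1 takes its place. *)
Lemma approx_link (x0 x : N) : pp_irreducible N -> linked N ->
  x0 <> 0 -> approx M x0 -> x <> 0 -> approx M x.
Proof.
move=> irrN linkN x00 ax0 x_neq0 s r t b sx xr tx xb.
have [k [[kann kdiv]|[kann kdiv]]] := linkN _ _ x00 x_neq0.
  have x0k : x0 <* k <> 0 by rewrite -[_ <* _]ract1 => /kann; rewrite ract1.
  have [t' tE] : exists t', t = t' * k.
    by apply: (div_cmp hR (x := x0 <* k)); [move/kdiv | exists x0].
  have t'x0 : ~ divides t' x0.
    by move=> h; apply/tx/kdiv; rewrite tE; exact: divMr.
  have [s' s'x0 sE] : exists2 s', divides s' x0 &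
      forall y : M, divides s' y -> divides s (y <* k).
    case: (left_chain hR s k) => -[v E].
      exists v; last by move=> y /(divMr k); rewrite E.
      by apply: (div_cancel irrN x0k); rewrite -E; exact/kdiv.
    exists 1; first exact: div1.
    by move=> y _; exists (y <* v); rewrite E ractM.
  have [||||y [s'y ykr t'y ykb]] := ax0 s' (k * r) t' (k * b) => //.
  - by rewrite ractM => /kann.
  - by rewrite ractM; exact/kann.
  rewrite ractM in ykr; exists (y <* k); split=> //; rewrite -?ractM //.
    exact: sE.
  rewrite tE => /irrM [//|yk]; apply: ykr; by rewrite yk ract0l.
have xk : x <* k <> 0 by rewrite -[_ <* _]ract1 => /kann; rewrite ract1.
have [b' bE] := ann_cmp hR xb xk.
have [r' x0r' rE] : exists2 r', x0 <* r' <> 0 &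
    forall y : M, y <* k <* r' <> 0 -> y <* r <> 0.
  case: (right_chain hR r k) => -[v E].
    by exists v => [/kann|y]; rewrite -ractM -E.
  exists 1; first by rewrite ract1.
  move=> y; rewrite ract1 E ractM => h yr; apply: h.
  by rewrite yr ract0l.
have [||||y [[w wE] yr' tky yb']] := ax0 (s * k) r' (t * k) b' => //.
- by apply/kdiv/divMr.
- by move=> /kdiv /irrN [].
- by apply/kann; rewrite -ractM -bE.
exists (w <* s); split; first by exists w.
- by apply: rE; rewrite -(ractM _ s) -wE.
- by move=> tw; apply: tky; rewrite wE ractM; exact: divMr.
- by rewrite bE ractM -(ractM _ s) -wE.
Qed.

End Approximation.

(** * Elimination of pp-quantifiers *)

Section Congruences.
Variables (R : pzRingType) (hR : uniserial R) (M : rmodType R).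
Implicit Types (x y z : M) (k a : R).

(* [x] lies in the subgroup [M k + ann a]. *)
Definition near_mult k a x := divides (k * a) (x <* a).

Lemma near_multP k a x : near_mult k a x <-> exists y, (x - y <* k) <* a = 0.
Proof.
split=> -[y yE]; exists y; first by rewrite ractBr yE ractM subrr.
by move/eqP: yE; rewrite ractBr subr_eq0 ractM => /eqP.
Qed.

Lemma near_mult_mono k a k' a' x :
  (exists h, k = h * k') -> (exists r, a' = a * r) ->
  near_mult k a x -> near_mult k' a' x.
Proof.
move=> [h ->] [r ->] /near_multP [y yE]; apply/near_multP; exists (y <* h).
by rewrite -ractM ractM yE ract0l.
Qed.

Lemma near_multD k a x y :
  near_mult k a x -> near_mult k a y -> near_mult k a (x + y).
Proof. by rewrite /near_mult ractDr; exact: divD. Qed.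

Lemma near_multN k a x : near_mult k a x -> near_mult k a (- x).
Proof. by rewrite /near_mult ractNl; exact: divN. Qed.

Lemma near_mult_div k a x : divides k x -> near_mult k a x.
Proof. exact: divMr. Qed.

Lemma near_mult_ann k a x : x <* a = 0 -> near_mult k a x.
Proof. by rewrite /near_mult => ->; exact: div_zero. Qed.

(** Together with [right_min]: M k1 + M k2 = M k and ann a1 + ann a2 = ann a, so the sum of two
    subgroups of the form M k + ann a has this form again. *)
Definition left_gen k1 k2 k :=
  [/\ k = k1 \/ k = k2, exists h, k1 = h * k & exists h, k2 = h * k].

Definition right_min a1 a2 a :=
  [/\ a = a1 \/ a = a2, exists h, a = a1 * h & exists h, a = a2 * h].

Lemma left_gen_ex k1 k2 : exists k, left_gen k1 k2 k.
Proof.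
have refl k : exists h, k = h * k by exists 1; rewrite mul1r.
by case: (left_chain hR k1 k2) => -[h E]; [exists k2 | exists k1]; split;
  by [left | right | exists h | exact: refl].
Qed.

(* [x] lies in the sum of the subgroups [M k1 + ann a1] and [M k2 + ann a2]. *)
Definition near_sum (p q : R * R) x := exists k a,
  [/\ left_gen p.1 q.1 k, right_min p.2 q.2 a & near_mult k a x].

(* Distributivity of the lattice generated by the two chains [M k], [ann a]. *)
Lemma near_sum_inter k a x (l : seq (R * R)) :
    (forall p, p \in l -> near_sum (k, a) p x) ->
  exists2 h, near_mult k a h &
    forall p, p \in l -> near_mult p.1 p.2 (x - h).
Proof.
move=> hl; have [kax|kax] := EM (near_mult k a x).
  by exists x => // p _; rewrite subrr; apply/near_mult_div/div_zero.
have refl1 c : exists h, c = h * c by exists 1; rewrite mul1r.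
have refl2 c : exists h, c = c * h by exists 1; rewrite mulr1.
(* Each [p] either contains both [x] and M k + ann a, or exceeds (k, a) in one component only.
   [M kb] and [ann ac] are the smallest such larger components, starting from all of M (kb = 1, ac =
   0); their intersection lies in every [p] of the second kind. *)
suff [kb [ac [[g kE] [g' acE] xkb xac hp]]] : exists kb ac,
  [/\ exists h, k = h * kb, exists h, ac = a * h,
      near_mult kb a x, near_mult k ac x &
      forall p, p \in l ->
        (forall d, divides kb d -> d <* ac = 0 -> near_mult p.1 p.2 d) \/
        (near_mult p.1 p.2 x /\
         forall h, near_mult k a h -> near_mult p.1 p.2 h)].
  have [y yE] := (near_multP _ _ _).1 xkb.
  have [y' y'E] := (near_multP _ _ _).1 xac.
  (* [x - h] is [y kb - y' k], which lies in M kb, and also [(x - y' k) - (x - y kb)], which lies in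
     ann ac. *)
  pose h := x - y <* kb + y' <* k.
  have hk : near_mult k a h.
    by apply/near_multP; exists y'; rewrite /h addrK.
  have dE : x - h = y <* kb - y' <* k.
    by rewrite /h opprD opprB addrA [x + _]addrC subrK.
  exists h => // p /hp [hd|[px hh]].
    apply: hd; rewrite dE.
      by apply: divB; [exists y | exists (y' <* g); rewrite -ractM -kE].
    have -> : y <* kb - y' <* k = (x - y' <* k) - (x - y <* kb).
      by rewrite opprB [RHS]addrC addrA subrK.
    by rewrite ractBr y'E acE ractM yE ract0l subrr.
  by apply: near_multD => //; apply/near_multN/hh.
elim: l hl => [|[pk pa] l IH] hl.
  exists 1, 0; split; rewrite ?mulr1 //.
  - by exists k; rewrite mulr1.
  - by exists 0; rewrite mulr0.
  - exact/near_mult_div/div1.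
  - by apply/near_mult_ann/ract0.
have [p pl|kb [ac [kkb aac xkb xac hp]]] := IH.
  by apply: hl; rewrite inE pl orbT.
have [ks [as_ [/= gk ga xs]]] := hl _ (mem_head _ _).
have keep d : (exists h, kb = h * pk) -> divides kb d -> near_mult pk pa d.
  by move=> [h ->] /divMl /near_mult_div.
have keep' d : (exists h, pa = ac * h) -> d <* ac = 0 -> near_mult pk pa d.
  by move=> [h ->] d0; apply: near_mult_ann; rewrite ractM d0 ract0l.
have mono k' a' : (exists h, ks = h * k') -> (exists r, a' = as_ * r) ->
    near_mult k' a' x by move=> ? ?; exact: near_mult_mono xs.
have [ks_or _ _] := gk; have [as_or _ _] := ga.
case: (left_chain hR k pk) => kpk; case: (right_chain hR pa a) => apa.
- exists kb, ac; split=> // p; rewrite inE => /orP[/eqP-> /=|/hp //]; right.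
  split; last by move=> h; exact: near_mult_mono.
  by apply: mono; [
    case: ks_or => ->; [exact: kpk | exact: refl1] |
    case: as_or => ->; [exact: apa | exact: refl2]].
- have xpk : near_mult pk a x.
    by apply: mono; [
      case: ks_or => ->; [exact: kpk | exact: refl1] |
      case: as_or => ->; [exact: refl2 | exact: apa]].
  case: (left_chain hR kb pk) => kbpk.
    exists kb, ac; split=> // p; rewrite inE => /orP[/eqP-> /=|/hp //]; left.
    by move=> d kbd _; exact: keep.
  exists pk, ac; split=> // p; rewrite inE => /orP[/eqP-> /=|/hp pp].
    by left=> d pkd _; exact: near_mult_div.
  case: pp => [pp|]; [left=> d pkd | by right].
  by apply: pp; case: kbpk pkd => h -> /divMl.
- have xpa : near_mult k pa x.
    by apply: mono; [
      case: ks_or => ->; [exact: refl1 | exact: kpk] |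
      case: as_or => ->; [exact: apa | exact: refl2]].
  case: (right_chain hR pa ac) => acpa.
    exists kb, ac; split=> // p; rewrite inE => /orP[/eqP-> /=|/hp //]; left.
    by move=> d _; exact: keep'.
  exists kb, pa; split=> // p; rewrite inE => /orP[/eqP-> /=|/hp pp].
    by left=> d _; exact: near_mult_ann.
  case: pp => [pp|]; [left=> d kbd dpa | by right].
  by apply: pp => //; case: acpa => h ->; rewrite ractM dpa ract0l.
(* Here the subgroup of [p] is contained in M k + ann a, so [x] would lie in the latter, which was
   excluded at the start. *)
- case: kax; apply: mono; last by case: as_or => ->; [exact: refl2 | exact: apa].
  by case: ks_or => ->; [exact: refl1 | exact: kpk].
Qed.

(** A solution [y] of the later congruences is corrected: [p.2 - y] splits into [h], in the first
    subgroup, and a remainder in all the later ones. *)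
Lemma near_mult_crt (l : seq (R * R * M)) :
    (forall p q, p \in l -> q \in l -> near_sum p.1 q.1 (p.2 - q.2)) ->
  exists x, forall p, p \in l -> near_mult p.1.1 p.1.2 (x - p.2).
Proof.
elim: l => [|p l IH] hl; first by exists 0.
have [q r ql rl|y yE] := IH; first by apply: hl; rewrite inE ?ql ?rl orbT.
have [|h hp hq] := @near_sum_inter p.1.1 p.1.2 (p.2 - y) [seq q.1 | q <- l].
  move=> _ /mapP [q ql ->].
  have [||k [a [gk ga kapq]]] := hl p q; rewrite ?mem_head ?inE ?ql ?orbT //.
  exists k, a; split=> //.
  rewrite -[p.2](subrK q.2) -addrA -[q.2 - y]opprB; apply: (near_multD kapq).
  apply: near_multN; apply: near_mult_mono (yE _ ql).
    by case: gk.
  by case: ga.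
exists (p.2 - h) => q; rewrite inE => /orP[/eqP->|ql].
  by rewrite addrAC subrr add0r; exact: near_multN.
have -> : p.2 - h - q.2 = (y - q.2) + (p.2 - y - h).
  by rewrite [RHS]addrC addrA; congr (_ - _); rewrite addrAC subrK.
by apply: near_multD; [exact: yE | apply: (hq q.1); exact: map_f].
Qed.

End Congruences.

(** * Eliminating variables from systems of divisibilities *)

Section Elimination.
Variables (R : pzRingType) (hR : uniserial R) (V : eqType).

Definition lincomb (M : rmodType R) (sol : V -> M) (e : seq (V * R)) : M :=
  \sum_(p <- e) sol p.1 <* p.2.

Definition congr_sol (M : rmodType R) (sol : V -> M) (c : R * seq (V * R)) :=
  divides c.1 (lincomb sol c.2).

Definition vars (S : seq (R * seq (V * R))) : seq V :=
  flatten [seq unzip1 c.2 | c <- S].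

Definition upd (M : rmodType R) (sol : V -> M) (v : V) (y : M) : V -> M :=
  fun u => if u == v then y else sol u.

Definition coef (v : V) (e : seq (V * R)) : R := \sum_(p <- e | p.1 == v) p.2.

Definition rest (v : V) (e : seq (V * R)) := [seq p <- e | p.1 != v].

Definition scale (r : R) (e : seq (V * R)) := [seq (p.1, p.2 * r) | p <- e].

Section Lincomb.
Variables (M : rmodType R).
Implicit Type sol : V -> M.

Lemma lincomb_cat sol e1 e2 :
  lincomb sol (e1 ++ e2) = lincomb sol e1 + lincomb sol e2.
Proof. exact: big_cat. Qed.

Lemma lincomb_scale sol r e : lincomb sol (scale r e) = lincomb sol e <* r.
Proof.
rewrite /lincomb big_map ract_suml; apply: eq_bigr => p _.
by rewrite ractM.
Qed.

Lemma lincomb_upd sol v y e :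
  lincomb (upd sol v y) e = y <* coef v e + lincomb sol (rest v e).
Proof.
rewrite /lincomb /rest big_filter (bigID (fun p => p.1 == v)) /= ract_sumr.
by congr (_ + _); apply: eq_bigr => p; rewrite /upd; case: eqP.
Qed.

End Lincomb.

Lemma unzip1_scale r e : unzip1 (scale r e) = unzip1 e.
Proof. by rewrite /unzip1 -map_comp. Qed.

(** The term in [v] is then a multiple of the modulus, so the condition does not constrain [v].
    Otherwise the modulus is a left multiple of the coefficient of [v]. *)
Let trivial v (c : R * seq (V * R)) := exists h, coef v c.2 = h * c.1.

Lemma elim_single v c : exists c' : R * seq (V * R),
  c'.2 = rest v c.2 /\
  (trivial v c /\ c'.1 = c.1 \/ ~ trivial v c /\ c'.1 = coef v c.2).
Proof.
have [h|h] := EM (trivial v c).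
  by exists (c.1, rest v c.2); split=> //; left.
by exists (coef v c.2, rest v c.2); split=> //; right.
Qed.

(** Multiplying [x - y] by a common right multiple [a] of the two coefficients gives a linear
    combination of the two rests, in which [x] and [y] no longer occur. *)
Lemma elim_pair v (kf : R * seq (V * R) -> R) cc : exists c' : R * seq (V * R),
  {subset unzip1 c'.2 <= unzip1 (rest v cc.1.2) ++ unzip1 (rest v cc.2.2)} /\
  exists k a, [/\ left_gen (kf cc.1) (kf cc.2) k,
    right_min (coef v cc.1.2) (coef v cc.2.2) a &
    forall (M : rmodType R) (sol : V -> M) (x y : M),
      lincomb sol (rest v cc.1.2) = x <* coef v cc.1.2 ->
      lincomb sol (rest v cc.2.2) = y <* coef v cc.2.2 ->
      (congr_sol sol c' <-> near_mult k a (x - y))].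
Proof.
case: cc => c1 c2 /=; have [k gk] := left_gen_ex hR (kf c1) (kf c2).
suff [r [s [a [ga ar as_]]]] : exists r s a,
    [/\ right_min (coef v c1.2) (coef v c2.2) a,
        a = coef v c1.2 * r & a = coef v c2.2 * s].
  exists (k * a, scale r (rest v c1.2) ++ scale (- s) (rest v c2.2)) => /=.
  split; first by rewrite /unzip1 map_cat -!/(unzip1 _) !unzip1_scale.
  exists k, a; split=> // M sol x y e1 e2.
  rewrite /congr_sol /near_mult /= lincomb_cat !lincomb_scale e1 e2.
  by rewrite -2!ractM mulrN -ar -as_ ractN ractBr.
case: (right_chain hR (coef v c1.2) (coef v c2.2)) => -[h E].
  exists 1, h, (coef v c1.2); split; rewrite ?mulr1 //.
  by split; [left | exists 1; rewrite mulr1 | exists h].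
exists h, 1, (coef v c2.2); split; rewrite ?mulr1 //.
by split; [right | exists h | exists 1; rewrite mulr1].
Qed.

Lemma mem_rest u v e :
  u \in unzip1 (rest v e) -> u != v /\ u \in unzip1 e.
Proof.
by case/mapP=> p; rewrite mem_filter => /andP[pv pe] ->; split=> //; exact: map_f.
Qed.

(** A nontrivial condition [k a | y a + rest] forces [rest = x a] and then says that [y] is
    congruent to [-x] modulo M k + ann a. The first demand is kept by [elim_single]; solvability of
    all the congruences is pairwise by [near_mult_crt], and [elim_pair] states it. *)
Lemma elim_var v S : exists S',
  (forall u, u \in vars S' -> u != v /\ u \in vars S) /\
  forall (M : rmodType R) (sol : V -> M),
    (exists y, forall c, c \in S -> congr_sol (upd sol v y) c) <->
    (forall c, c \in S' -> congr_sol sol c).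
Proof.
have /choice [kf kfP] : forall c : R * seq (V * R), exists k,
    ~ trivial v c -> c.1 = k * coef v c.2.
  move=> c; case: (left_chain hR c.1 (coef v c.2)) => -[k E].
    by exists k.
  by exists 0 => /(_ (ex_intro _ k E)).
have /choice [tc tcP] := elim_single v.
have /choice [pc pcP] := elim_pair v kf.
pose NT := [seq c <- S | `[< ~ trivial v c >]].
have NTP c : c \in NT -> ~ trivial v c /\ c \in S.
  by rewrite mem_filter => /andP[/asboolP].
exists (map tc S ++ [seq pc (c1, c2) | c1 <- NT, c2 <- NT]); split.
  move=> u /flatten_mapP [c]; rewrite mem_cat => /orP[/mapP [c0 c0S ->]|].
    rewrite (tcP c0).1 => /mem_rest [uv uc]; split=> //.
    by apply/flatten_mapP; exists c0.
  case/allpairsP => -[c1 c2] /= [/NTP [_ c1S] /NTP [_ c2S] ->].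
  move=> /(pcP (c1, c2)).1; rewrite mem_cat.
  by case/orP=> /mem_rest [uv uc]; split=> //; apply/flatten_mapP;
    first [by exists c1 | by exists c2].
move=> M sol; split=> [[y yS] c|hS'].
  have ntE c0 : c0 \in NT -> exists2 x, lincomb sol (rest v c0.2) =
      x <* coef v c0.2 & near_mult (kf c0) (coef v c0.2) (y + x).
    move=> /NTP [/kfP c0E /yS]; rewrite /congr_sol lincomb_upd c0E => -[x xE].
    exists (x <* kf c0 - y).
      by rewrite ractBr -ractM -xE addrAC subrr add0r.
    by apply: near_mult_div; exists x; rewrite addrC subrK.
  rewrite mem_cat => /orP[/mapP [c0 c0S ->]|].
    rewrite /congr_sol (tcP c0).1; case: (tcP c0).2 => -[tr ->]; last first.
      have [|x -> _] := ntE c0; last by exists x.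
      by rewrite mem_filter c0S andbT; exact/asboolP.
    have := yS _ c0S; rewrite /congr_sol lincomb_upd.
    case: tr => h ->; rewrite ractM => -[x xE]; exists (x - y <* h).
    by rewrite ractBr -xE addrAC subrr add0r.
  case/allpairsP => -[c1 c2] /= [/ntE [x1 E1 n1] /ntE [x2 E2 n2] ->].
  have [k [a [gk ga /(_ M sol x1 x2 E1 E2) h]]] := (pcP (c1, c2)).2.
  apply/h; have -> : x1 - x2 = (y + x1) - (y + x2).
    by rewrite opprD addrACA subrr add0r.
  apply: near_multD; last apply: near_multN.
    by apply: near_mult_mono n1; [case: gk | case: ga].
  by apply: near_mult_mono n2; [case: gk | case: ga].
have /choice [xf xfP] : forall c : R * seq (V * R), exists x : M,
    c \in NT -> lincomb sol (rest v c.2) = x <* coef v c.2.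
  move=> c; have [cNT|cNT] := EM (c \in NT); last by exists 0.
  have [nt cS] := NTP _ cNT.
  have : congr_sol sol (tc c).
    by apply: hS'; rewrite mem_cat map_f.
  by rewrite /congr_sol (tcP c).1; case: (tcP c).2 => [[/nt]|[_ ->] [x xE]] //; exists x.
have [|y yE] := @near_mult_crt _ hR _
  [seq ((kf c, coef v c.2), - xf c) | c <- NT].
  move=> _ _ /mapP [c1 c1N ->] /mapP [c2 c2N ->] /=.
  have [k [a [gk ga h]]] := (pcP (c2, c1)).2.
  have {h} := (h M sol _ _ (xfP _ c2N) (xfP _ c1N)).1.
  rewrite opprK addrC => h.
  exists k, a; split=> /=.
  - by case: gk => o ? ?; split=> //; case: o; [right|left].
  - by case: ga => o ? ?; split=> //; case: o; [right|left].
  apply: h; apply: hS'; rewrite mem_cat; apply/orP; right.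
  by apply/allpairsP; exists (c2, c1).
exists y => c cS; rewrite /congr_sol lincomb_upd.
have [tr|nt] := EM (trivial v c).
  have : congr_sol sol (tc c) by apply: hS'; rewrite mem_cat map_f.
  rewrite /congr_sol (tcP c).1; case: (tcP c).2 => [[_ ->]|[/(_ tr)]] // cx.
  by apply: divD => //; case: tr => h ->; exists (y <* h); rewrite ractM.
have cNT : c \in NT by rewrite mem_filter cS andbT; exact/asboolP.
rewrite (xfP _ cNT) -ractDr (kfP _ nt) -[xf c]opprK.
exact: (yE _ (map_f _ cNT)).
Qed.

Lemma elim_vars (vs : seq V) S : exists S',
  (forall u, u \in vars S' -> u \notin vs /\ u \in vars S) /\
  forall (M : rmodType R) (sol : V -> M),
    (exists2 sol' : V -> M, {in [predC vs], sol =1 sol'} &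
       forall c, c \in S -> congr_sol sol' c) <->
    (forall c, c \in S' -> congr_sol sol c).
Proof.
elim: vs => [|v vs [S1 [S1v S1P]]].
  exists S; split=> // M sol; split=> [[sol' ss' hS] c cS|hS]; last by exists sol.
  suff -> : sol = sol' by exact: hS.
  by apply: funext => u; exact: ss'.
have [S2 [S2v S2P]] := elim_var v S1; exists S2; split.
  move=> u /S2v [uv /S1v [uvs uS]]; split=> //.
  by rewrite inE negb_or uv.
move=> M sol; split=> [[sol' ss' hS]|/S2P [y /S1P [sol' ss' hS]]].
  apply/S2P; exists (sol' v); apply/S1P; exists sol' => // u.
  rewrite inE /upd => uvs; case: eqP => [-> //|/eqP uv].
  by apply: ss'; rewrite !inE negb_or uv.
exists sol' => // u; rewrite !inE negb_or => /andP[uv uvs].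
by rewrite -ss' ?inE // /upd (negPf uv).
Qed.

End Elimination.

(** * Characters with values in Q/Z *)

Section RationalsModZ.

Definition is_int_rat := [pred x : rat | x \is a Num.int].

Lemma is_int_rat_zmod_closed : zmod_closed is_int_rat.
Proof. by split=> [|x y]; rewrite !inE ?rpred0 //; exact: rpredB. Qed.

HB.instance Definition _ :=
  GRing.isZmodClosed.Build rat is_int_rat is_int_rat_zmod_closed.

Definition QZ : zmodType := Quotient.quot is_int_rat.

Definition toQZ : {additive rat -> QZ} := \pi_(Quotient.quot is_int_rat)%qT.

Lemma toQZ_eq0 x : toQZ x = 0 <-> x \is a Num.int.
Proof.
have := Quotient.idealrBE is_int_rat x 0; rewrite subr0 inE => ->.
split=> [h|/eqP h]; last by rewrite -[RHS](raddf0 toQZ).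
by apply/eqP; rewrite -[LHS]/(toQZ x) h -[LHS](raddf0 toQZ).
Qed.

Lemma toQZ_surj d : exists x, toQZ x = d.
Proof. by exists (repr d); exact: reprK. Qed.

Lemma QZ_divisible (d : QZ) n : (0 < n)%N -> exists e, e *+ n = d.
Proof.
move=> n0; have [x <-] := toQZ_surj d; exists (toQZ (x / n%:R)).
by rewrite -raddfMn -(mulr_natr (x / _)) divfK // pnatr_eq0 -lt0n.
Qed.

End RationalsModZ.

(** * Injectivity of Q/Z and separation by characters *)

Section Injectivity.
Variable G : zmodType.

(** The graph of an additive map from a subgroup of G to Q/Z. *)
Definition additive_rel (S : set (G * QZ)) :=
  [/\ S (0, 0), forall p q, S p -> S q -> S (p - q) &
      forall d, S (0, d) -> d = 0].

Lemma additive_relMz S p (n : int) : additive_rel S -> S p -> S (p *~ n).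
Proof.
move=> [S0 SB _] Sp.
have SN q : S q -> S (- q) by move=> Sq; rewrite -[- q]add0r; exact: SB.
have SD q r : S q -> S r -> S (q + r).
  by move=> Sq Sr; rewrite -[r]opprK; apply: (SB q) => //; exact: SN.
have Sn k : S (p *+ k) by elim: k => [|k IH] //; rewrite mulrS; exact: SD.
by case: n => k; [exact: Sn | exact/SN/(Sn k.+1)].
Qed.

(** Baer's argument: the value [e] at [g] must satisfy [n e = d] whenever [(n g, d)] is in S. Such
    [n] are multiples of the least positive one, for which divisibility of Q/Z provides [e]; if
    there is none, [e = 0] works. *)
Lemma additive_rel_extend S g : additive_rel S ->
  exists S' : set (G * QZ),
    [/\ additive_rel S', (S `<=` S')%classic & exists d, S' (g, d)].
Proof.
move=> aS; have [S0 SB Sfun] := aS.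
have SD q r : S q -> S r -> S (q + r).
  move=> Sq Sr; rewrite -[r]opprK; apply: (SB q) => //.
  by rewrite -[- r]add0r; exact: SB.
have pairMz (x : G) (d : QZ) (n : int) : (x, d) *~ n = (x *~ n, d *~ n).
  have pairMn k : (x, d) *+ k = (x *+ k, d *+ k).
    by elim: k => [|k IH] //; rewrite !mulrS IH.
  case: n => k; first exact: pairMn.
  by rewrite NegzE !mulrNz; exact: (congr1 -%R (pairMn k.+1)).
suff [e eP] : exists e, forall (n : int) d, S (g *~ n, d) -> d = e *~ n.
  exists [set p | exists2 q, S q & exists n : int, p = q + (g, e) *~ n]%classic.
  split.
  - split.
    + by exists (0, 0) => //; exists 0; rewrite mulr0z addr0.
    + move=> _ _ [p Sp [n ->]] [q Sq [m ->]].
      exists (p - q); first exact: SB.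
      by exists (n - m); rewrite mulrzBr opprD addrACA.
    + move=> d [[q1 q2] Sq [n]]; rewrite -[_ *~ n]/((g, e) *~ n).
      rewrite pairMz.
      case=> q1E ->.
      have /eP : S (g *~ (- n), q2).
        by move/esym/eqP: q1E; rewrite addr_eq0 mulrNz => /eqP <-.
      by rewrite mulrNz => ->; rewrite addNr.
  - by move=> p Sp; exists p => //; exists 0; rewrite mulr0z addr0.
  - by exists e; exists (0, 0) => //; exists 1; rewrite add0r mulr1z.
pose P n := `[< exists d, S (g *+ n.+1, d) >].
have [exP|noP] := EM (exists n, P n).
  case: (ex_minnP exP) => k /asboolP [d0 Sd0] kmin.
  have [e eE] := QZ_divisible d0 (ltn0Sn k); exists e => m d Sm.
  have [q [r [mE r_ge0 r_lt]]] : exists q r : int,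
      [/\ m = k.+1%:Z * q + r, 0 <= r & r < k.+1%:Z].
    exists (m %/ k.+1%:Z)%Z, (m %% k.+1%:Z)%Z.
    by rewrite mulrC -divz_eq modz_ge0 ?ltz_pmod.
  have Sr : S (g *~ r, d - d0 *~ q).
    have -> : (g *~ r, d - d0 *~ q) = (g *~ m, d) - (g *+ k.+1, d0) *~ q.
      rewrite pairMz; congr (_, _).
      by rewrite /= mE mulrzDr mulrzA addrAC subrr add0r.
    by apply: (SB _ _ Sm); exact: additive_relMz.
  case: r r_ge0 r_lt mE Sr => // -[|r] _ r_lt mE Sr.
    move/Sfun/eqP: Sr; rewrite subr_eq0 => /eqP ->.
    by rewrite mE addr0 -eE mulrzA.
  have /kmin : P r by apply/asboolP; eexists; exact: Sr.
  by rewrite leqNgt; move: r_lt; rewrite ltz_nat ltnS => ->.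
exists 0 => m d Sm; rewrite mul0rz.
case: m Sm => [[|m]|m] Sm; first exact: Sfun.
  by case: noP; exists m; apply/asboolP; exists d.
case: noP; exists m; apply/asboolP; exists (- d).
have := SB _ _ S0 Sm; rewrite sub0r.
by rewrite -[- (_, _)]/(- (g *~ Negz m), - d) NegzE mulrNz opprK.
Qed.

Lemma QZ_injective S : additive_rel S ->
  exists chi : G -> QZ, (forall x y, chi (x - y) = chi x - chi y) /\
    forall x d, S (x, d) -> chi x = d.
Proof.
move=> aS.
pose P (T : set (G * QZ)) := T = set0 \/ additive_rel T /\ (S `<=` T)%classic.
have [F FP Ftot|A [PA Amax]] := @Zorn_bigcup _ P.
  have [[T0 FT0 T0n]|nF] := EM (exists2 T, F T & T <> set0); last first.
    left; apply/seteqP; split=> // p [T FT Tp]; case: nF; exists T => //.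
    by move=> T0; rewrite T0 in Tp.
  have ne T p : F T -> T p -> additive_rel T /\ (S `<=` T)%classic.
    by move=> FT Tp; case: (FP _ FT) => // T0'; rewrite T0' in Tp.
  have [[T00 _ _] ST0] : additive_rel T0 /\ (S `<=` T0)%classic.
    by case: (FP _ FT0).
  right; split; last by move=> p /ST0 ?; exists T0.
  split; first by exists T0.
    move=> p q [T1 FT1 T1p] [T2 FT2 T2q].
    have [T12|T21] := Ftot _ _ FT1 FT2.
      by exists T2 => //; have [[_ TB _] _] := ne _ _ FT2 T2q; apply/TB/T2q/T12.
    by exists T1 => //; have [[_ TB _] _] := ne _ _ FT1 T1p; apply: TB => //; exact: T21.
  by move=> d [T FT Td]; have [[_ _ Tf] _] := ne _ _ FT Td; exact: Tf.
have [aA SA] : additive_rel A /\ (S `<=` A)%classic.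
  case: PA => // A0; have [S0 _ _] := aS.
  case: (Amax S); last by right; split.
  by rewrite A0; split; [exact: sub0set | move=> /(_ _ S0)].
have [A0 AB Af] := aA.
have Atot g : exists d, A (g, d).
  have [B [aB AsubB [d Bgd]]] := additive_rel_extend g aA.
  have [BA|nBA] := EM (B `<=` A)%classic; first by exists d; exact: BA.
  by case: (Amax B); [split | right; split=> // p /SA /AsubB].
have /choice [chi chiP] := Atot.
have uniq g d : A (g, d) -> chi g = d.
  move=> Agd; apply/eqP; rewrite -subr_eq0; apply/eqP/Af.
  by have := AB _ _ (chiP g) Agd; rewrite -[(_, _) - _]/(g - g, _) subrr.
exists chi; split=> [x y|x d /SA /uniq //].
exact/uniq/(AB _ _ (chiP x) (chiP y)).
Qed.

(** [w] is sent to 1/k, where [k] is the order of [w] modulo H, or 2 if that order is infinite. It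
    is enough that [k > 1] divides every [n] with [n w] in H. *)
Lemma QZ_separates (H : set G) w :
    H 0 -> (forall x y, H x -> H y -> H (x - y)) -> ~ H w ->
  exists chi : G -> QZ, [/\ forall x y, chi (x - y) = chi x - chi y,
    forall h, H h -> chi h = 0 & chi w <> 0].
Proof.
move=> H0 HB nHw.
have HN x : H x -> H (- x) by move=> Hx; rewrite -[- x]add0r; exact: HB.
have HMn x k : H x -> H (x *+ k).
  move=> Hx; elim: k => // k IH; rewrite mulrS -[x *+ k]opprK.
  by apply: HB => //; exact: HN.
have invZ k n : (0 < k)%N -> toQZ (n%:R / k%:R) = 0 -> (k %| n)%N.
  move=> k0 /toQZ_eq0 /intrP [m mE].
  have k0' : (k%:R : rat) != 0 by rewrite pnatr_eq0 -lt0n.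
  have : n%:Z = m * k%:Z.
    by apply: (intr_inj (R := rat)); rewrite rmorphM /= -mE divfK.
  by move=> E; rewrite -(absz_nat n) E abszM dvdn_mull.
suff [k [k1 kP]] : exists k, (1 < k)%N /\ forall n, H (w *+ n) -> (k %| n)%N.
  have k0 := ltnW k1; pose d := toQZ (k%:R^-1).
  have dk n : (k %| n)%N -> d *+ n = 0.
    case/dvdnP=> q ->; rewrite mulnC mulrnA.
    suff -> : d *+ k = 0 by rewrite mul0rn.
    rewrite /d -raddfMn; apply/toQZ_eq0.
    by rewrite -(mulr_natr (k%:R^-1)) mulVf ?rpred1 // pnatr_eq0 -lt0n.
  have dkz (n : int) : H (w *~ n) -> d *~ n = 0.
    case: n => n; first by move=> /kP /dk.
    rewrite NegzE !mulrNz => /HN; rewrite opprK => /kP /dk.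
    by rewrite -pmulrn => ->; rewrite oppr0.
  pose S : set (G * QZ) :=
    [set p | exists2 h, H h & exists n : int, p = (h + w *~ n, d *~ n)]%classic.
  have aS : additive_rel S.
    split.
    - by exists 0 => //; exists 0; rewrite !mulr0z addr0.
    - move=> _ _ [h Hh [n ->]] [h' Hh' [n' ->]]; exists (h - h'); first exact: HB.
      by exists (n - n'); rewrite !mulrzBr -addrACA -opprD.
    - move=> e [h Hh [n [/esym/eqP hE ->]]]; apply: dkz.
      by move: hE; rewrite addrC addr_eq0 => /eqP ->; exact: HN.
  have [chi [chiB chiS]] := QZ_injective aS.
  exists chi; split=> // [h Hh|].
    by apply: chiS; exists h => //; exists 0; rewrite !mulr0z addr0.
  rewrite (chiS w d); last by exists 0 => //; exists 1; rewrite add0r !mulr1z.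
  rewrite /d -[k%:R^-1]mul1r => /(invZ k 1%N k0).
  by rewrite dvdn1 => /eqP k1'; rewrite k1' in k1.
have [ex|nex] := EM (exists n, `[< H (w *+ n.+1) >]); last first.
  exists 2%N; split=> // -[|n] // Hn.
  by case: nex; exists n; exact/asboolP.
case: (ex_minnP ex) => k /asboolP Hk kmin; exists k.+1; split.
  by case: k Hk {kmin} => //; rewrite mulr1n.
move=> n Hn; rewrite /dvdn; case E : (n %% k.+1)%N => [|r] //.
have : H (w *+ r.+1).
  rewrite -E; move: Hn; rewrite {1}(divn_eq n k.+1) mulrnDr mulnC mulrnA => Hn.
  rewrite -[w *+ _](addKr (w *+ k.+1 *+ (n %/ k.+1))) addrC.
  by apply: HB => //; exact: HMn.
move=> /asboolP /kmin; rewrite leqNgt.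
by have := ltn_pmod n (ltn0Sn k); rewrite E ltnS => ->.
Qed.

End Injectivity.

(** * The bidual of M/Z as a right module *)

Section Bidual.
Variables (R : pzRingType) (M : rmodType R).

Record submodule := Submodule {
  in_sub :> M -> Prop;
  sub0 : in_sub 0;
  subB : forall x y, in_sub x -> in_sub y -> in_sub (x - y);
  subM : forall x r, in_sub x -> in_sub (x <* r) }.

Variable Z : submodule.

(** Characters of M vanishing on Z are Hom(M/Z, Q/Z); so [bidual Z] is the bidual of M/Z, obtained
    without forming a quotient module. *)
Definition is_char (chi : M -> QZ) :=
  (forall x y, chi (x - y) = chi x - chi y) /\ (forall z, Z z -> chi z = 0).

Definition char_pred : pred (M -> QZ) := fun chi => `[< is_char chi >].

Lemma char_zmod_closed : zmod_closed char_pred.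
Proof.
split=> [|f g]; rewrite /in_mem /= /char_pred !asboolE.
  by split=> [x y|z _] //=; rewrite subr0.
move=> [fB fZ] [gB gZ]; split=> [x y|z zZ].
  by rewrite /= !fctE fB gB !opprD addrACA.
by rewrite !fctE fZ // gZ // subrr.
Qed.

HB.instance Definition _ :=
  GRing.isZmodClosed.Build (M -> QZ) char_pred char_zmod_closed.

Record char := Char { char_fun :> M -> QZ; char_funP : char_pred char_fun }.

HB.instance Definition _ := [isSub for char_fun].
HB.instance Definition _ := [Choice of char by <:].
HB.instance Definition _ := [SubChoice_isSubZmodule of char by <:].

Lemma charB (chi : char) x y : chi (x - y) = chi x - chi y.
Proof. by case: chi => f fP; have /asboolP [fB _] := fP; exact: fB. Qed.

Lemma charZ (chi : char) z : Z z -> chi z = 0.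
Proof. by case: chi => f fP; have /asboolP [_ fZ] := fP; exact: fZ. Qed.

Lemma char0 (chi : char) : chi 0 = 0.
Proof. by have := charB chi 0 0; rewrite !subrr. Qed.

Lemma charD (chi : char) x y : chi (x + y) = chi x + chi y.
Proof. by rewrite -{1}[y]opprK charB -[- y]sub0r charB char0 sub0r opprK. Qed.

Lemma char_addE (f g : char) x : (f + g) x = f x + g x.
Proof. by []. Qed.

Lemma char_ext (f g : char) : (forall x, f x = g x) -> f = g.
Proof. by move=> fg; apply: val_inj; apply: funext. Qed.

Lemma char_act_subproof (r : R) (chi : char) :
  char_pred (fun x => chi (x <* r)).
Proof.
apply/asboolP; split=> [x y|z zZ] /=; first by rewrite ractBr charB.
by rewrite charZ //; exact: subM.
Qed.

Definition char_act (r : R) (chi : char) : char :=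
  Char (char_act_subproof r chi).

Definition bidual_pred : pred (char -> QZ) :=
  fun F => `[< forall f g, F (f - g) = F f - F g >].

Lemma bidual_zmod_closed : zmod_closed bidual_pred.
Proof.
split=> [|F G]; rewrite /in_mem /= /bidual_pred !asboolE; first by move=> f g /=; rewrite subr0.
move=> FB GB f g.
by rewrite !fctE FB GB !opprD addrACA.
Qed.

HB.instance Definition _ :=
  GRing.isZmodClosed.Build (char -> QZ) bidual_pred bidual_zmod_closed.

Record bidual := Bidual {
  bidual_fun :> char -> QZ; bidual_funP : bidual_pred bidual_fun }.

HB.instance Definition _ := [isSub for bidual_fun].
HB.instance Definition _ := [Choice of bidual by <:].
HB.instance Definition _ := [SubChoice_isSubZmodule of bidual by <:].

Lemma bidualB (F : bidual) f g : F (f - g) = F f - F g.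
Proof. by case: F => F FP; have /asboolP FB := FP; exact: FB. Qed.

Lemma bidual0 (F : bidual) : F 0 = 0.
Proof. by have := bidualB F 0 0; rewrite !subrr. Qed.

Lemma bidualD (F : bidual) f g : F (f + g) = F f + F g.
Proof. by rewrite -{1}[g]opprK bidualB -[- g]sub0r bidualB bidual0 sub0r opprK. Qed.

Lemma bidual_sum (F : bidual) (I : Type) (l : seq I) (G : I -> char) :
  F (\sum_(i <- l) G i) = \sum_(i <- l) F (G i).
Proof.
by elim/big_rec2: _ => [|i a b _ <-]; rewrite ?bidual0 // bidualD.
Qed.

Lemma bidual_ext (F G : bidual) : (forall f, F f = G f) -> F = G.
Proof. by move=> FG; apply: val_inj; apply: funext. Qed.

Lemma bidual_act_subproof (r : R) (F : bidual) :
  bidual_pred (fun f => F (char_act r f)).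
Proof.
apply/asboolP => f g; rewrite -bidualB; congr (bidual_fun _ _).
by apply: char_ext => x.
Qed.

Definition bidual_act (r : GRing.converse R) (F : bidual) : bidual :=
  Bidual (bidual_act_subproof r F).

Lemma bidual_actA a b F :
  bidual_act a (bidual_act b F) = bidual_act (a * b) F.
Proof.
apply: bidual_ext => f; congr (bidual_fun F _); apply: char_ext => x /=.
by rewrite -ractM.
Qed.

Lemma bidual_act1 : left_id 1 bidual_act.
Proof.
move=> F; apply: bidual_ext => f; congr (bidual_fun F _).
by apply: char_ext => x /=; rewrite ract1.
Qed.

Lemma bidual_actDr : right_distributive bidual_act +%R.
Proof. by move=> a F G; apply: bidual_ext. Qed.

Lemma bidual_actDl F : {morph bidual_act^~ F : a b / a + b}.
Proof.
move=> a b; apply: bidual_ext => f.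
rewrite -[RHS]/(F (char_act a f) + F (char_act b f)) -bidualD.
congr (bidual_fun F _); apply: char_ext => x.
by rewrite char_addE /= ractDl charD.
Qed.

HB.instance Definition _ :=
  GRing.Zmodule_isLmodule.Build (GRing.converse R) bidual
    bidual_actA bidual_act1 bidual_actDr bidual_actDl.

Lemma bidual_ractE (F : bidual) r f : (F <* r) f = F (char_act r f).
Proof. by []. Qed.

Lemma bidual_sumE (I : Type) (l : seq I) (P : pred I) (F : I -> bidual) f :
  (\sum_(i <- l | P i) F i) f = \sum_(i <- l | P i) F i f.
Proof. by elim/big_rec2: _ => // i a b _ <-. Qed.

Lemma eval_subproof (x : M) : bidual_pred (fun f : char => f x).
Proof. by apply/asboolP. Qed.

Definition to_bidual (x : M) : bidual := Bidual (eval_subproof x).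

Lemma to_bidualD x y : to_bidual (x + y) = to_bidual x + to_bidual y.
Proof. by apply: bidual_ext => f; exact: charD. Qed.

Lemma to_bidual_ract x r : to_bidual (x <* r) = to_bidual x <* r.
Proof. exact: bidual_ext. Qed.

End Bidual.

Lemma lincomb_coef (R : pzRingType) (V : eqType) (M : rmodType R) (sol : V -> M)
    (vs : seq V) (e : seq (V * R)) : uniq vs -> {subset unzip1 e <= vs} ->
  lincomb sol e = \sum_(v <- vs) sol v <* coef v e.
Proof.
move=> vsU; elim: e => [|[u r] e IH] evs.
  by rewrite /lincomb big_nil big1 // => v _; rewrite /coef big_nil ract0.
rewrite /lincomb big_cons -/(lincomb _ _) /= IH; last first.
  by move=> v ve; apply: evs; rewrite inE ve orbT.
have uvs : u \in vs by apply: evs; rewrite inE eqxx.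
rewrite !(bigD1_seq u) //= addrA; congr (_ + _).
  by rewrite /coef big_cons /= eqxx ractDl.
by apply: eq_bigr => v vu; rewrite /coef big_cons /= eq_sym (negPf vu).
Qed.

Lemma coef_notin (R : pzRingType) (V : eqType) (e : seq (V * R)) v :
  v \notin unzip1 e -> coef v e = 0.
Proof.
move=> ve; rewrite /coef big_seq_cond big1 // => p /andP[pe /eqP pv].
by case/negP: ve; rewrite -pv; exact: map_f.
Qed.

Definition alg_compact (R : pzRingType) (M : rmodType R) :=
  forall (V : choiceType) (E : seq (V * R) * M -> Prop),
    (forall L : seq (seq (V * R) * M), (forall e, e \in L -> E e) ->
      exists sol : V -> M, forall e, e \in L -> lincomb sol e.1 = e.2) ->
  exists sol : V -> M, forall e, E e -> lincomb sol e.1 = e.2.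

(** * Purity and algebraic compactness of the bidual *)

Section BidualPurity.
Variables (R : pzRingType) (M : rmodType R) (Z : submodule M).

Let single m (j : 'I_m) (x : M) : 'I_m -> M := fun i => if i == j then x else 0.

(** If the constants lay outside the group H of right-hand sides solvable modulo Z, a character of
    M^m would kill H but not the constants. Its components belong to [char Z], and evaluating the
    equations solved by [Y] at them gives 0. Applied to empty linear forms, this is injectivity of
    M/Z into the bidual. *)
Lemma bidual_pure (V : choiceType) (L : seq (seq (V * R) * M)) :
    (exists Y : V -> bidual Z, forall e, e \in L ->
       lincomb Y e.1 = to_bidual Z e.2) ->
  exists y : V -> M, forall e, e \in L -> Z (lincomb y e.1 - e.2).
Proof.
case=> Y YL; pose m := size L; pose e0 := ([::] : seq (V * R), 0 : M).
pose eq (j : 'I_m) := nth e0 L j.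
pose H : set ('I_m -> M) := [set g | exists y : V -> M, forall j,
  Z (lincomb y (eq j).1 - g j)]%classic.
suff [y Hy] : H (fun j => (eq j).2).
  exists y => e /(nthP e0) [i im <-]; exact: (Hy (Ordinal im)).
have lin0 e : lincomb (fun=> 0 : M) e = 0 :> M.
  by rewrite /lincomb big1 // => p _; rewrite ract0l.
have linB (y y' : V -> M) e :
    lincomb (fun v => y v - y' v) e = lincomb y e - lincomb y' e.
  by rewrite /lincomb -sumrB; apply: eq_bigr => p _; rewrite ractBr.
apply: contrapT => nH.
have [||chi [chiB chiH chiw]] := QZ_separates _ _ nH.
- by exists (fun=> 0) => j; rewrite lin0 subr0; exact: sub0.
- move=> f g [y yP] [y' y'P]; exists (fun v => y v - y' v) => j.
  have -> : lincomb (fun v => y v - y' v) (eq j).1 - (f - g) j =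
      (lincomb y (eq j).1 - f j) - (lincomb y' (eq j).1 - g j).
    rewrite linB -[(f - g) j]/(f j - g j) !opprB addrACA [RHS]addrACA.
    by congr (_ + _); rewrite addrC.
  exact: (subB (yP j) (y'P j)).
have chi0 : chi 0 = 0 by have := chiB 0 0; rewrite !subrr.
have chiD f g : chi (f + g) = chi f + chi g.
  by rewrite -{1}[g]opprK chiB -[- g]sub0r chiB chi0 sub0r opprK.
have chi_sum (I : Type) (l : seq I) (F : I -> 'I_m -> M) :
    chi (\sum_(i <- l) F i) = \sum_(i <- l) chi (F i).
  by elim/big_rec2: _ => // i a b _ <-.
have charj j : char_pred Z (fun x => chi (single j x)).
  apply/asboolP; split=> [x y|z zZ].
    rewrite -chiB; congr chi; apply: funext => i; rewrite /single -[RHS]/(_ - _).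
    by case: eqP => //; rewrite subrr.
  apply: chiH; exists (fun=> 0) => i; rewrite lin0 sub0r /single.
  case: eqP => _; last by rewrite oppr0; exact: sub0.
  by rewrite -[- z]sub0r; apply: subB => //; exact: sub0.
pose ch j := Char (charj j).
have decomp g : chi g = \sum_j ch j (g j).
  rewrite -chi_sum; congr chi; apply: funext => i.
  rewrite fct_sumE (bigD1 i) //= /single eqxx big1 ?addr0 // => k ki.
  by rewrite eq_sym (negPf ki).
pose vs := undup (flatten [seq unzip1 e.1 | e <- L]).
have vsP j : {subset unzip1 (eq j).1 <= vs}.
  move=> v ve; rewrite mem_undup; apply/flatten_mapP; exists (eq j) => //.
  exact: mem_nth.
apply: chiw; rewrite decomp.
under eq_bigr => j _.
  rewrite -[ch j _]/(to_bidual Z (eq j).2 (ch j)) -YL ?mem_nth //.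
  rewrite (lincomb_coef _ (undup_uniq _) (@vsP j)) bidual_sumE.
  under eq_bigr => v _ do rewrite bidual_ractE.
  over.
rewrite exchange_big big1 //= => v _; rewrite -bidual_sum.
rewrite -[RHS](bidual0 (Y v)); congr (bidual_fun _ _); apply: char_ext => x.
have -> : (\sum_j char_act (coef v (eq j).1) (ch j)) x =
    \sum_j ch j (x <* coef v (eq j).1).
  by elim/big_rec2: _ => // i a b _ <-.
rewrite -(decomp (fun j => x <* coef v (eq j).1)); apply: chiH.
exists (fun u => if u == v then x else 0) => j.
have -> : lincomb (fun u => if u == v then x else 0) (eq j).1 =
    x <* coef v (eq j).1.
  by rewrite -[LHS]/(lincomb (upd (fun=> 0) v x) _) lincomb_upd lin0 addr0.
by rewrite subrr; exact: sub0.
Qed.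

End BidualPurity.

Section BidualCompact.
Variables (R : pzRingType) (M : rmodType R) (Z : submodule M).

Lemma bidual_lincomb (V : eqType) (sol : V -> bidual Z) vs e f :
    uniq vs -> {subset unzip1 e <= vs} ->
  lincomb sol e f = \sum_(v <- vs) sol v (char_act (coef v e) f).
Proof. by move=> vsU evs; rewrite (lincomb_coef _ vsU evs) bidual_sumE. Qed.

Lemma char_act0 (f : char Z) : char_act 0 f = 0.
Proof. by apply: char_ext => x; rewrite /= ract0 char0. Qed.

Lemma char_actN r (f : char Z) : char_act r (- f) = - char_act r f.
Proof. exact: char_ext. Qed.

(* A linear system over [Hom_Z(A, QZ)] prescribes the values of an additive map
   on a subgroup of [A ^ V]; finite solvability makes these values consistent. *)
Lemma bidual_alg_compact : alg_compact (bidual Z).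
Proof.
move=> V E Efin.
pose emb (e : seq (V * R)) (f : char Z) : V -> char Z :=
  fun v => char_act (coef v e) f.
have embN e f : emb e (- f) = - emb e f.
  by apply: funext => v; exact: char_actN.
pose S : set ((V -> char Z) * QZ) := [set p | exists l : seq
    ((seq (V * R) * bidual Z) * char Z), (forall q, q \in l -> E q.1) /\
    p = (\sum_(q <- l) emb q.1.1 q.2, \sum_(q <- l) (q.1.2 : bidual Z) q.2)]%classic.
have aS : additive_rel S.
  split.
  - by exists [::]; rewrite !big_nil.
  - move=> _ _ [l [lE ->]] [l' [lE' ->]].
    exists (l ++ [seq (q.1, - q.2) | q <- l']); split.
      by move=> q; rewrite mem_cat => /orP[/lE //|/mapP [q' /lE' ? ->]].
    rewrite !big_cat !big_map /= -[LHS]/(_ - _, _ - _) -!sumrN.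
    by congr (_ + _, _ + _); apply: eq_bigr => q _ //=;
      rewrite -[in RHS]sub0r bidualB bidual0 sub0r.
  - move=> d [l [lE [l0 ->]]].
    have [|Y YP] := Efin [seq q.1 | q <- l].
      by move=> _ /mapP [q /lE ? ->].
    pose vs := undup (flatten [seq unzip1 q.1.1 | q <- l]).
    rewrite (eq_big_seq (fun q => \sum_(v <- vs) Y v (emb q.1.1 q.2 v))).
      rewrite exchange_big big1 //= => v _; rewrite -bidual_sum.
      rewrite -[RHS](bidual0 (Y v)); congr (bidual_fun _ _).
      by rewrite -[RHS]/((0 : V -> char Z) v) l0 fct_sumE.
    move=> q ql; rewrite -YP ?map_f //; apply: bidual_lincomb.
      exact: undup_uniq.
    by move=> v vq; rewrite mem_undup; apply/flatten_mapP; exists q.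
have [Phi [PhiB PhiS]] := QZ_injective aS.
have Phi0 : Phi 0 = 0 by have := PhiB 0 0; rewrite !subrr.
have PhiD f g : Phi (f + g) = Phi f + Phi g.
  by rewrite -{1}[g]opprK PhiB -[- g]sub0r PhiB Phi0 sub0r opprK.
pose single v (f : char Z) : V -> char Z := fun u => if u == v then f else 0.
have solP v : bidual_pred (fun f => Phi (single v f)).
  apply/asboolP => f g; rewrite -PhiB; congr Phi; apply: funext => u.
  by rewrite /single -[RHS]/(_ - _); case: eqP; rewrite ?subrr.
exists (fun v => Bidual (solP v)) => -[e c] Ee; apply: bidual_ext => f.
rewrite (bidual_lincomb _ _ (undup_uniq (unzip1 e))); last first.
  by move=> v; rewrite mem_undup.
have -> : c f = Phi (emb e f).
  by symmetry; apply: PhiS; exists [:: ((e, c), f)]; split;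
    [move=> q; rewrite inE => /eqP -> | rewrite !big_seq1].
have -> : emb e f =
    \sum_(v <- undup (unzip1 e)) single v (char_act (coef v e) f).
  apply: funext => u; rewrite fct_sumE /single.
  have [ue|ue] := boolP (u \in unzip1 e).
    rewrite (bigD1_seq u) ?undup_uniq ?mem_undup //= eqxx big1 ?addr0 // => v vu.
    by rewrite eq_sym (negPf vu).
  rewrite big_seq big1; first by rewrite /emb coef_notin // char_act0.
  move=> v; rewrite mem_undup => ve; case: eqP => // uv.
  by rewrite uv ve in ue.
by elim/big_rec2: _ => [|v a b _ ->] /=; rewrite ?Phi0 ?PhiD.
Qed.

End BidualCompact.

(** * Algebraic compactness and pure-injectivity *)

Section LinearOf.
Variables (R : pzRingType) (X M : rmodType R) (f : X -> M).

Definition linear_of (fD : forall x y, f (x + y) = f x + f y)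
  (fM : forall x r, f (x <* r) = f x <* r) : X -> M := f.

Lemma linear_of_linear fD fM : linear (@linear_of fD fM).
Proof. by move=> a x y; rewrite /linear_of fD; congr (_ + _); exact: fM. Qed.

HB.instance Definition _ fD fM :=
  GRing.isLinear.Build (GRing.converse R) X M *:%R (@linear_of fD fM)
    (linear_of_linear fD fM).

Lemma linearP_ex : (forall x y, f (x + y) = f x + f y) ->
  (forall x r, f (x <* r) = f x <* r) ->
  exists g : {linear X -> M}, g =1 f.
Proof. by move=> fD fM; exists (linear_of fD fM). Qed.

End LinearOf.

Section LinearTheory.
Variables (R : pzRingType) (X M : rmodType R) (f : {linear X -> M}).

Lemma linear_ract x r : f (x <* r) = f x <* r.
Proof. exact: linearZ. Qed.

Lemma linear_div s x : divides s x -> divides s (f x).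
Proof. by case=> y ->; exists (f y); exact: linear_ract. Qed.

Lemma linear_lincomb (V : eqType) (sol : V -> X) e :
  f (lincomb sol e) = lincomb (f \o sol) e.
Proof. by rewrite linear_sum; apply: eq_bigr => p _; exact: linear_ract. Qed.

End LinearTheory.

(** * Homomorphisms as solutions of linear systems *)

Section Compactness.
Variable R : pzRingType.
Implicit Types M N X : rmodType R.

(** This turns the construction of homomorphisms into solving linear systems with one unknown for
    each element of X. *)
Lemma relations_linear X M (sol : X -> M) :
    (forall e, lincomb id e = 0 -> lincomb sol e = 0) ->
  exists g : {linear X -> M}, g =1 sol.
Proof.
move=> solE; have := fun e => solE e; rewrite /lincomb => h.
have D x y : sol (x + y) = sol x + sol y.
  have := h [:: (x, 1); (y, 1); (x + y, -1)].
  rewrite !big_cons !big_nil !addr0 /= !ractN !ract1 !addrA subrr => /(_ erefl).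
  by move/eqP; rewrite subr_eq0 => /eqP.
have Z x r : sol (x <* r) = sol x <* r.
  have := h [:: (x, r); (x <* r, -1)].
  rewrite !big_cons !big_nil !addr0 /= !ractN !ract1 subrr => /(_ erefl).
  by move/eqP; rewrite subr_eq0 => /eqP.
exact: linearP_ex D Z.
Qed.

Lemma alg_compact_retract M N (i : {linear N -> M}) (g : {linear M -> N}) :
  cancel i g -> alg_compact M -> alg_compact N.
Proof.
move=> ig cM V E Efin.
have [L|sol solE] := cM V (fun e => exists2 e0, E e0 & e = (e0.1, i e0.2)).
  move=> LE; have /choice [h hP] : forall e : seq (V * R) * M, exists e0,
      e \in L -> E e0 /\ e = (e0.1, i e0.2).
    move=> e; have [eL|eL] := EM (e \in L); last by exists ([::], 0).
    by have [e0 ? ?] := LE _ eL; exists e0.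
  have [|sol solP] := Efin (map h L).
    by move=> _ /mapP [e /hP [? _] ->].
  exists (i \o sol) => e eL; have [_ ->] := hP _ eL.
  by rewrite -linear_lincomb solP ?map_f.
exists (g \o sol) => e Ee.
by rewrite -linear_lincomb (solE (e.1, i e.2)) ?ig //; exists e.
Qed.

(** In a finite part of the system defining [f], eliminating the unknowns that stand for elements of
    X leaves divisibilities in two variables. They hold at [(u1, u2)], hence at [(w1, w2)], so the
    finite part is solvable in M. *)
Lemma alg_compact_linear M X (u1 u2 : X) (w1 w2 : M) : uniserial R ->
    alg_compact M ->
    (forall d a b, divides d (u1 <* a + u2 <* b) ->
       divides d (w1 <* a + w2 <* b)) ->
  exists f : {linear X -> M}, f u1 = w1 /\ f u2 = w2.
Proof.
move=> hR cM huw.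
pose E (e : seq (X * R) * M) := exists ab : R * R,
  lincomb id e.1 = u1 <* ab.1 + u2 <* ab.2 /\ e.2 = w1 <* ab.1 + w2 <* ab.2.
have [L LE|sol solE] := cM X E.
  have /choice [ab abP] : forall e, exists ab : R * R, e \in L ->
      lincomb id e.1 = u1 <* ab.1 + u2 <* ab.2 /\ e.2 = w1 <* ab.1 + w2 <* ab.2.
    move=> e; have [eL|eL] := EM (e \in L); last by exists (0, 0).
    by have [ab abE] := LE _ eL; exists ab.
  pose V := (X + bool)%type.
  pose eqn (e : seq (X * R) * M) : seq (V * R) :=
    [seq (inl p.1, p.2) | p <- e.1] ++
    [:: (inr true, - (ab e).1); (inr false, - (ab e).2)].
  have eqnE (M' : rmodType R) (s : V -> M') e : lincomb s (eqn e) =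
      lincomb (s \o inl) e.1 -
        (s (inr true) <* (ab e).1 + s (inr false) <* (ab e).2).
    rewrite /eqn lincomb_cat /lincomb big_map; congr (_ + _).
    by rewrite !big_cons big_nil addr0 /= !ractN opprD.
  pose S := [seq (0 : R, eqn e) | e <- L].
  pose isl (v : V) := if v is inl _ then true else false.
  have [S' [S'v S'P]] := elim_vars hR (filter isl (vars S)) S.
  have S'r c p : c \in S' -> p \in c.2 -> ~~ isl p.1.
    move=> cS pc; have : p.1 \in vars S'.
      by apply/flatten_mapP; exists c => //; exact: map_f.
    by case/S'v => h1 h2; apply: contra h1; rewrite mem_filter h2 andbT.
  have two (M' : rmodType R) (s : V -> M') c : c \in S' -> lincomb s c.2 =
      s (inr true) <* coef (inr true) c.2 + s (inr false) <* coef (inr false) c.2.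
    move=> cS; rewrite (@lincomb_coef _ _ _ _ [:: inr true; inr false]) //.
      by rewrite !big_cons big_nil addr0.
    move=> _ /mapP [p /(S'r _ _ cS) + ->].
    by case: (p.1) => // -[] _; rewrite !inE eqxx ?orbT.
  pose sX (v : V) : X :=
    match v with inl x => x | inr true => u1 | inr false => u2 end.
  pose sM (v : V) : M :=
    match v with inl x => 0 | inr true => w1 | inr false => w2 end.
  have S'X : forall c, c \in S' -> congr_sol sX c.
    apply/S'P; exists sX => // _ /mapP [e eL ->].
    rewrite /congr_sol /= eqnE (abP _ eL).1.
    by apply/div0; rewrite subrr.
  have /S'P [s sE sS] : forall c, c \in S' -> congr_sol sM c.
    by move=> c cS; have := S'X _ cS; rewrite /congr_sol !two //; exact: huw.
  exists (s \o inl) => e eL; have [_ ->] := abP _ eL.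
  have : congr_sol s (0, eqn e) by apply: sS; exact: map_f.
  rewrite /congr_sol /= eqnE => /div0 /eqP; rewrite subr_eq0 => /eqP ->.
  have inrP b : inr b \in [predC filter isl (vars S)].
    by rewrite inE mem_filter.
  by rewrite -!sE ?inrP.
have lin1 (s : X -> M) x : lincomb s [:: (x, 1)] = s x.
  by rewrite /lincomb big_seq1 ract1.
have linX (x : X) r : lincomb id [:: (x, r)] = x <* r by rewrite /lincomb big_seq1.
have [e e0|f fE] := @relations_linear _ _ sol.
  by apply: (solE (e, 0)); exists (0, 0); rewrite /= !ract0 !addr0.
exists f; rewrite !fE; split.
  rewrite -lin1 (solE ([:: (u1, 1)], w1)) //.
  by exists (1, 0); rewrite /= linX !ract0 !addr0 !ract1.
rewrite -lin1 (solE ([:: (u2, 1)], w2)) //.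
by exists (0, 1); rewrite /= linX !ract0 !add0r !ract1.
Qed.

End Compactness.

Section PureInjective.
Variable R : pzRingType.
Implicit Types M N X : rmodType R.

(** By [bidual_pure] with Z zero, N is pure in its bidual, hence a retract of an algebraically
    compact module. *)
Lemma pure_injective_alg_compact N : pure_injective N -> alg_compact N.
Proof.
move=> piN.
have zM (x : N) (r : R) : x = 0 -> x <* r = 0 by move=> ->; exact: ract0l.
have zB (x y : N) : x = 0 -> y = 0 -> x - y = 0 by move=> -> ->; rewrite subrr.
pose Z := @Submodule R N (fun x => x = 0) erefl zB zM.
have [i iE] := linearP_ex (to_bidualD Z) (to_bidual_ract Z).
have [|g gi] := piN _ i; last first.
  exact: (alg_compact_retract gi (@bidual_alg_compact _ _ Z)).
split=> [x y|n phi x [Y YE]].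
  rewrite !iE => xy; pose L := [:: ([::] : seq (nat * R), x - y)].
  have [|s /(_ _ (mem_head _ _))] := bidual_pure (Z := Z) (L := L).
    exists (fun=> 0) => e; rewrite inE => /eqP -> /=.
    by rewrite /lincomb big_nil -iE linearB /= !iE xy subrr.
  by rewrite /= /lincomb big_nil sub0r => /eqP; rewrite oppr_eq0 subr_eq0 => /eqP.
pose A := pp_matrix phi; pose b := pp_bound phi.
pose row j := [seq (k, A (lshift n k) j) | k : 'I_b].
pose rhs j : N := - \sum_(k < n) x k <* A (rshift b k) j.
have rowE (M' : rmodType R) (s : 'I_b -> M') j :
    lincomb s (row j) = \sum_(k < b) s k <* A (lshift n k) j.
  by rewrite /lincomb /row /image_mem big_map big_enum.
have [|y yE] := bidual_pure (Z := Z) (L := [seq (row j, rhs j) | j : 'I_(pp_eqs phi)]).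
  exists Y => _ /mapP [j _ ->] /=; rewrite rowE -iE linearN linear_sum.
  apply/eqP; rewrite -addr_eq0; apply/eqP; rewrite -[RHS](YE j); congr (_ + _).
  by apply: eq_bigr => k _; rewrite linear_ract.
exists y => j; have := yE _ (map_f (fun j => (row j, rhs j)) (mem_enum predT j)).
by rewrite /= rowE /rhs opprK.
Qed.

(** A retraction is a solution in N of all equations whose constant [c] is such that the elements of
    X satisfy them with [f c] instead; purity solves the finite parts. *)
Lemma alg_compact_pure_injective N : alg_compact N -> pure_injective N.
Proof.
move=> cN X f [finj fpure].
have [L LE|sol solE] := cN X (fun e => lincomb id e.1 = f e.2).
  pose vs := undup (flatten [seq unzip1 e.1 | e <- L]).
  pose e0 := ([::] : seq (X * R), 0 : N).
  pose n := size L; pose eq (j : 'I_n) := nth e0 L j.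
  (* The bound variables stand for the elements of X that occur, the free ones for the constants,
     which enter with coefficient -1. *)
  pose phi : pp_formula R n := PPFormula (col_mx
    (\matrix_(i < size vs, j < n) coef (nth 0 vs i) (eq j).1) (- 1%:M)).
  have vsP j : {subset unzip1 (eq j).1 <= vs}.
    move=> v ve; rewrite mem_undup; apply/flatten_mapP; exists (eq j) => //.
    exact: mem_nth.
  have rhsE (M' : rmodType R) (w : 'I_n -> M') j :
      \sum_(k < n) w k <* pp_matrix phi (rshift (size vs) k) j = - w j.
    rewrite (bigD1 j) //= big1 => [|k kj].
      by rewrite col_mxEd !mxE eqxx ractN ract1 addr0.
    by rewrite col_mxEd !mxE (negPf kj) oppr0 ract0.
  have lhsE (M' : rmodType R) (s : X -> M') j :
      \sum_(i < size vs) s (nth 0 vs i) <* pp_matrix phi (lshift n i) j =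
      lincomb s (eq j).1.
    rewrite (lincomb_coef _ (undup_uniq _) (@vsP j)) (big_nth 0) big_mkord.
    by apply: eq_bigr => i _; rewrite col_mxEu mxE.
  have /fpure [y yE] : pp_sol phi (f \o (fun j => (eq j).2)).
    exists (fun i => nth 0 vs i) => j; rewrite [X in X + _](lhsE X id j) rhsE /=.
    by rewrite (LE (eq j)) ?subrr //; exact: mem_nth.
  pose s v := if insub (index v vs) is Some i then y i else 0.
  exists s => e /(nthP e0) [j jn <-]; have := yE (Ordinal jn).
  rewrite rhsE => /eqP; rewrite subr_eq0 => /eqP <-; rewrite -[nth e0 L j]/(eq (Ordinal jn)).
  rewrite -lhsE; apply: eq_bigr => i _; rewrite /s index_uniq ?undup_uniq //.
  by rewrite valK.
have [e e0|g gE] := @relations_linear _ _ _ sol.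
  by apply: (solE (e, 0)); rewrite linear0.
exists g => x; rewrite gE; have /= := solE ([:: (f x, 1)], x).
by rewrite /lincomb !big_seq1 /= !ract1; apply.
Qed.

Lemma alg_compact_prescribe M X (T : X * M -> Prop) : alg_compact M ->
    (forall L : seq (X * M), (forall p, p \in L -> T p) ->
      exists f : {linear X -> M}, forall p, p \in L -> f p.1 = p.2) ->
  exists f : {linear X -> M}, forall p, T p -> f p.1 = p.2.
Proof.
move=> cM Tfin.
have [L LE|sol solE] := cM X (fun e => lincomb id e.1 = 0 /\ e.2 = 0 \/
    exists2 p, T p & e = ([:: (p.1, 1)], p.2)).
  have /choice [h hP] : forall e : seq (X * R) * M, exists l : seq (X * M),
      e \in L -> (forall p, p \in l -> T p) /\
        (lincomb id e.1 = 0 /\ e.2 = 0 \/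
         exists2 p, p \in l & e = ([:: (p.1, 1)], p.2)).
    move=> e; have [eL|eL] := EM (e \in L); last by exists [::].
    have [e0|[p Tp ->]] := LE _ eL; first by exists [::]; split=> //; left.
    exists [:: p]; split=> [q|]; first by rewrite inE => /eqP ->.
    by right; exists p; rewrite ?mem_head.
  have [|f fP] := Tfin (flatten (map h L)).
    by move=> p /flatten_mapP [e /hP [lT _] /lT].
  exists f => e eL; have [_ [[e1 ->]|[p pe ->]]] := hP _ eL.
    by rewrite -[lincomb f _]/(lincomb (f \o id) _) -linear_lincomb e1 linear0.
  rewrite /lincomb big_seq1 ract1 fP //.
  by apply/flatten_mapP; exists e.
have [e e0|g gE] := @relations_linear _ _ _ sol.
  by apply: (solE (e, 0)); left.
exists g => p Tp; rewrite gE.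
have /= := solE ([:: (p.1, 1)], p.2) (or_intror (ex_intro2 _ _ p Tp erefl)).
by rewrite /lincomb big_seq1 ract1.
Qed.

End PureInjective.

(** * Hulls of elements *)

Lemma chain_max (T : eqType) (C : T -> Prop) (le : T -> T -> Prop) (l : seq T) a0 :
    C a0 -> (forall a, le a a) -> (forall a b c, le a b -> le b c -> le a c) ->
    (forall a b, C a -> C b -> le a b \/ le b a) ->
  exists2 b, C b & forall a, a \in l -> C a -> le a b.
Proof.
move=> Ca0 lexx letr Ctot; elim: l => [|a l [b Cb bl]]; first by exists a0.
have [Ca|nCa] := EM (C a); last first.
  by exists b => // c; rewrite inE => /orP[/eqP->|/bl].
have [ab|ba] := Ctot _ _ Ca Cb.
  by exists b => // c; rewrite inE => /orP[/eqP->|/bl].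
exists a => // c; rewrite inE => /orP[/eqP->//|cl Cc].
exact: letr (bl _ cl Cc) ba.
Qed.

Section Hull.
Variables (R : pzRingType) (M : rmodType R).
Hypothesis cM : alg_compact M.
Implicit Types (f g h k : {linear M -> M}) (B : set M).

(* [B] is essential over [x]: endomorphisms fixing [x] preserve the pp-type of
   [B]. *)
Definition essential (x : M) B := forall g, g x = x ->
  exists k, k x = x /\ forall b, B b -> k (g b) = b.

(** For the union of a chain, finitely many requirements on [k] concern a single member of the
    chain, so compactness provides one [k] for the whole union. *)
Lemma essential_max x : exists2 B, essential x B &
  forall B', (B `<=` B')%classic -> essential x B' -> (B' `<=` B)%classic.
Proof.
have [F Fess Ftot|B [Bess Bmax]] := @Zorn_bigcup _ (essential x); last first.
  exists B => // B' BB' B'ess; apply: contrapT => nB'B.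
  by apply: (Bmax B').
move=> g gx.
have [L LT|k kT] := alg_compact_prescribe (X := M)
    (T := fun p => p = (x, x) \/ exists2 B, F B & B p.2 /\ p.1 = g p.2) cM.
  have /choice [Bf BfP] : forall p : M * M, exists B, p \in L ->
      p = (x, x) \/ F B /\ B p.2 /\ p.1 = g p.2.
    move=> p; have [pL|pL] := EM (p \in L); last by exists set0.
    by have [->|[B FB Bp]] := LT _ pL; [exists set0; left | exists B; right].
  have [[p0 FB0]|noF] := EM (exists p, F (Bf p)); last first.
    exists idfun => p pL; have [->|[FB _]] := BfP _ pL => //.
    by case: noF; exists p.
  have [p1 FB1 p1max] := @chain_max _ (fun p => F (Bf p))
    (fun p q => (Bf p `<=` Bf q)%classic) L p0 FB0 (fun _ => @subset_refl _ _)
    (fun a b c => @subset_trans _ _ _ _) (fun a b => @Ftot _ _).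
  have [k [kx kB]] := Fess _ FB1 g gx.
  exists k => p pL; have [->//|[FB [Bp ->]]] := BfP _ pL.
  exact/kB/(p1max p).
exists k; split; first by apply: (kT (x, x)); left.
by move=> b [B FB Bb]; apply: (kT (g b, b)); right; exists B.
Qed.

(* Maximality is for the pp-type of the family [f m]: by compactness, inclusion
   of these types is expressed by [h \o f = g]. *)
Lemma maximal_fixing B : exists2 f : {linear M -> M}, (forall b, B b -> f b = b) &
  forall g, (forall b, B b -> g b = b) ->
    (exists h, forall m, h (f m) = g m) -> exists h, forall m, h (g m) = f m.
Proof.
pose fixes f := forall b, B b -> f b = b.
pose T := {f : {linear M -> M} | fixes f}.
pose below (f g : {linear M -> M}) := exists h, forall m, h (f m) = g m.
have below_refl f : below f f by exists idfun.
have below_trans f g h : below f g -> below g h -> below f h.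
  move=> [u uE] [v vE]; exists (v \o u : {linear M -> M}) => m /=.
  by rewrite uE vE.
pose t0 : T := exist _ (idfun : {linear M -> M}) (fun b _ => erefl).
have [| |C Ctot|[f ffix] fmax] := @ZL_preorder T t0
    (fun s t : T => `[< below (sval s) (sval t) >]).
- by move=> t; apply/asboolP; exact: below_refl.
- by move=> r s t /asboolP rs /asboolP st; apply/asboolP; exact: below_trans st.
- have {}Ctot (f g : T) :
      C f -> C g -> below (sval f) (sval g) \/ below (sval g) (sval f).
    by move=> Cf Cg; have [/asboolP|/asboolP] := Ctot _ _ Cf Cg; [left|right].
  have [[f0 Cf0]|C0] := EM (exists f : T, C f); last first.
    by exists t0 => s Cs; case: C0; exists s.
  (* The unknown [(None, m)] is the value at [m] of an upper bound g of the chain, and [(Some t, m)]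
     that of a map h_t with h_t \o t = g. *)
  pose V : choiceType := {classic (option T * M)}.
  pose rel (o : option T) (e : seq (M * R)) : seq (V * R) :=
    [seq ((o, p.1) : V, p.2) | p <- e].
  have relE (s : V -> M) o e : lincomb s (rel o e) = lincomb (fun m => s (o, m)) e.
    by rewrite /lincomb big_map.
  pose E (e : seq (V * R) * M) :=
    [\/ exists o e', lincomb id e' = 0 /\ e = (rel o e', 0),
        exists2 b, B b & e = (rel None [:: (b, 1)], b) |
        exists t m, C t /\ e = (rel (Some t) [:: (sval t m, 1)] ++
                                rel None [:: (m, -1)], 0)].
  have [L LE|s sE] := cM (V := V) (E := E).
    have /choice [tf tfP] : forall e : seq (V * R) * M, exists t, e \in L ->
        [\/ exists o e', lincomb id e' = 0 /\ e = (rel o e', 0),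
          exists2 b, B b & e = (rel None [:: (b, 1)], b) |
          C t /\ exists m, e = (rel (Some t) [:: (sval t m, 1)] ++
                                rel None [:: (m, -1)], 0)].
      move=> e; have [eL|eL] := EM (e \in L); last by exists f0.
      have [h|h|[t [m [Ct eE]]]] := LE _ eL.
      - by exists f0 => _; exact: Or31.
      - by exists f0 => _; exact: Or32.
      - by exists t => _; apply: Or33; split=> //; exists m.
    have [t1 Ct1 t1max] := @chain_max {classic T} C
      (fun s t : T => below (sval s) (sval t)) (map tf L) f0 Cf0
      (fun s => below_refl _) (fun r s t => @below_trans _ _ _) Ctot.
    have /choice [u uP] : forall t : T, exists u : {linear M -> M},
        below (sval t) (sval t1) -> forall m, u (sval t m) = sval t1 m.
      move=> t; have [[u uE]|nb] := EM (below (sval t) (sval t1)); first by exists u.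
      by exists idfun => /nb.
    exists (fun v => if v.1 is Some t then u t v.2 else sval t1 v.2).
    move=> e eL; have [[o [e' [e'0 ->]]]|[b Bb ->]|[Ct [m ->]]] := tfP _ eL.
    - rewrite relE; case: o => [t|].
        by rewrite -[LHS]/(lincomb (u t \o id) e') -linear_lincomb e'0 linear0.
      by rewrite -[LHS]/(lincomb (sval t1 \o id) e') -linear_lincomb e'0 linear0.
    - rewrite relE /lincomb big_seq1 ract1 /=; exact: (svalP t1).
    - rewrite lincomb_cat !relE /lincomb !big_seq1 /= ract1 ractN ract1.
      rewrite uP ?subrr //; apply: t1max => //; exact: map_f.
  have lin o e' : lincomb id e' = 0 -> lincomb (fun m => s (o, m)) e' = 0.
    move=> e'0; rewrite -relE; apply: (sE (_, 0)).
    by apply: Or31; exists o, e'.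
  have [g gE] := relations_linear (lin None).
  have gfix : fixes g.
    move=> b Bb; rewrite gE.
    have /= := sE (rel None [:: (b, 1)], b) (Or32 _ _ (ex_intro2 _ _ b Bb erefl)).
    by rewrite /lincomb big_seq1 ract1.
  exists (exist _ g gfix) => t Ct; apply/asboolP.
  have [h hE] := relations_linear (lin (Some t)); exists h => m.
  have /= := sE (_, 0) (Or33 _ _ (ex_intro _ t (ex_intro _ m (conj Ct erefl)))).
  rewrite /lincomb !big_cons big_nil addr0 /= ract1 ractN ract1 hE gE.
  by move/eqP; rewrite subr_eq0 => /eqP.
exists f => // g gfix [h hE].
have /asboolP := fmax (exist _ g gfix) (asboolT (ex_intro _ h hE)).
by [].
Qed.

(** The range of a maximal [f] fixing a maximal essential [B] is again essential: if [k] undoes [g]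
    on B, then [k \o g \o f] fixes B and lies above [f], so some [h] takes it back to [f]. Hence the
    range lies in B, where [f] is the identity. *)
Lemma hull_idempotent x : exists e : {linear M -> M},
  [/\ forall m, e (e m) = e m, e x = x &
      forall g, g x = x -> exists k, forall m, k (g (e m)) = e m].
Proof.
have [B Bess Bmax] := essential_max x.
have Bx : B x.
  apply: (Bmax (B `|` [set x])%classic); first by move=> b; left.
    move=> g gx; have [k [kx kB]] := Bess g gx.
    by exists k; split=> // b [/kB//|->]; rewrite gx.
  by right.
have [f fB fmax] := maximal_fixing B.
have Bf : (range f `<=` B)%classic.
  apply: Bmax => [b Bb|g gx]; first by exists b => //; exact: fB.
  have [k [kx kB]] := Bess g gx.
  have [||h hE] := fmax (k \o g \o f : {linear M -> M}).
  - by move=> b Bb /=; rewrite fB // kB.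
  - by exists (k \o g : {linear M -> M}).
  exists (h \o k : {linear M -> M}); split=> [|_ [m _ <-]] /=; last exact: hE.
  by have := hE x; rewrite /= fB // gx.
have ff m : f (f m) = f m by apply/fB/Bf; exists m.
exists f; split=> //; first exact: fB.
move=> g gx; have [k [_ kB]] := Bess g gx.
by exists k => m; apply/kB/Bf; exists m.
Qed.

End Hull.

Section FixedPoints.
Variables (R : pzRingType) (M : rmodType R) (e : {linear M -> M}).

Definition fixed_pred : pred M := fun m => e m == m.

Lemma fixed_submod_closed : submod_closed fixed_pred.
Proof.
split=> [|a u v]; rewrite /in_mem /= /fixed_pred ?linear0 //.
by move=> /eqP eu /eqP ev; rewrite linearP eu ev.
Qed.

HB.instance Definition _ :=
  GRing.isSubmodClosed.Build (GRing.converse R) M fixed_pred fixed_submod_closed.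

Record fixed := Fixed { fixed_val : M; fixed_valP : fixed_pred fixed_val }.

HB.instance Definition _ := [isSub for fixed_val].
HB.instance Definition _ := [Choice of fixed by <:].
HB.instance Definition _ := [SubChoice_isSubLmodule of fixed by <:].

Lemma fixed_incl : exists i : {linear fixed -> M}, i =1 fixed_val.
Proof. by apply: linearP_ex. Qed.

Hypothesis ee : forall m, e (e m) = e m.

Lemma fixed_projP m : fixed_pred (e m).
Proof. exact/eqP. Qed.

Lemma fixed_proj : exists p : {linear M -> fixed},
  forall m, fixed_val (p m) = e m.
Proof.
have [x y|x r|p pE] := @linearP_ex _ _ _ (fun m => Fixed (fixed_projP m)).
- by apply: val_inj; rewrite /= linearD.
- by apply: val_inj; rewrite /= linear_ract.
by exists p => m; rewrite pE.
Qed.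

End FixedPoints.

(** * Irreducibility and linkedness of indecomposable pure-injectives *)

Section Indecomposable.
Variables (R : pzRingType) (hR : uniserial R) (N : rmodType R).
Hypotheses (iN : indecomposable N) (cN : alg_compact N).

Lemma indecomposable_idempotent (e : {linear N -> N}) x :
  (forall m, e (e m) = e m) -> e x = x -> x <> 0 -> forall m, e m = m.
Proof.
move=> ee ex x0.
have [m m'|m r|e' e'E] := @linearP_ex _ _ _ (fun m => m - e m).
- by rewrite linearD opprD addrACA.
- by rewrite linear_ract ractBr.
have ee' m : e' (e' m) = e' m by rewrite !e'E linearB ee subrr subr0.
have [p pE] := fixed_proj ee; have [p' p'E] := fixed_proj ee'.
have [m m'|m r|f fE] := @linearP_ex _ N (fixed e * fixed e')%type
  (fun m => (p m, p' m)); first by rewrite !linearD.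
  by rewrite !linear_ract.
have fbij : bijective f.
  exists (fun ab : fixed e * fixed e' => fixed_val ab.1 + fixed_val ab.2).
    by move=> m; rewrite fE /= pE p'E e'E addrC subrK.
  move=> [[a pa] [b pb]]; rewrite fE /=; have ea := eqP pa.
  have eb0 : e b = 0.
    have /eqP := eqP pb; rewrite e'E -subr_eq0 addrAC subrr sub0r oppr_eq0.
    by move/eqP.
  by congr (_, _); apply: val_inj; rewrite /= ?pE ?p'E ?e'E linearD ea eb0 addr0 // addrC addKr.
have [tA|tB] := iN.2 _ _ (ex_intro _ f fbij).
  by case: x0; rewrite -ex -pE (tA (p x)).
move=> m; have := congr1 (@fixed_val _ _ _) (tB (p' m)).
by rewrite p'E e'E => /eqP; rewrite subr_eq0 => /eqP.
Qed.

(** The hull idempotent of [x] is the identity, so [f] has a left inverse [k]. It fixes [x] as well,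
    so it has a left inverse too, which can only be [f]. *)
Lemma fixing_bijective x (f : {linear N -> N}) : x <> 0 -> f x = x ->
  exists k : {linear N -> N}, cancel f k /\ cancel k f.
Proof.
move=> x0 fx; have [e [ee ex eP]] := hull_idempotent cN x.
have e1 := indecomposable_idempotent ee ex x0.
have [k kE] := eP f fx; have kf m : k (f m) = m by have := kE m; rewrite e1.
have [k' k'E] : exists k' : {linear N -> N}, forall m, k' (k (e m)) = e m.
  by apply: eP; rewrite -{1}fx kf.
have k'k m : k' (k m) = m by have := k'E m; rewrite e1.
have k'f m : k' m = f m by rewrite -{1}[m]kf k'k.
by exists k; split=> // m; rewrite -k'f k'k.
Qed.

(** A pair (k, a) that refines (s, r) in both components replaces it. Otherwise M s lies in M k, or
    [a] is a right multiple of [r] and then [u a = x a]. *)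
Lemma near_mult_common (x : N) (l : seq (R * R)) s r :
    (forall p, p \in l -> near_mult p.1 p.2 x) -> near_mult s r x ->
  exists u : N, [/\ divides s u, u <* r = x <* r &
    forall p, p \in l -> near_mult p.1 p.2 u].
Proof.
elim: l s r => [|[k a] l IH] s r hl xsr.
  by case: xsr => y yE; exists (y <* s); split; [exists y | rewrite yE ractM |].
have xka := hl _ (mem_head _ _); have {}hl p : p \in l -> near_mult p.1 p.2 x.
  by move=> pl; apply: hl; rewrite inE pl orbT.
have [[[h kE] [h' rE]]|hard] := EM ((exists h, k = h * s) /\ (exists h, r = a * h)).
  have [u [ku ua ul]] := IH _ _ hl xka; exists u; split.
  - by move: ku; rewrite kE => /divMl.
  - by rewrite rE !ractM ua.
  - by move=> p; rewrite inE => /orP[/eqP->|/ul //]; exact: near_mult_div.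
have [u [su ur ul]] := IH _ _ hl xsr; exists u; split=> // p.
rewrite inE => /orP[/eqP-> /=|/ul //].
case: (left_chain hR k s) => [kE|[h sE]]; last first.
  by apply: near_mult_div; move: su; rewrite sE => /divMl.
case: (right_chain hR r a) => [rE|[h aE]]; first by case: hard.
by rewrite /near_mult aE ractM ur -ractM -aE.
Qed.

Lemma near_mult_compact (x : N) s r : near_mult s r x ->
  exists u : N, [/\ divides s u, u <* r = x <* r &
    forall d c, divides d (x <* c) -> divides d (u <* c)].
Proof.
move=> xsr; pose V : choiceType := option (option (R * R)).
pose eqC (p : R * R) : seq (V * R) * N :=
  ([:: (None, p.2); (Some (Some p), - p.1)], 0).
pose E (e : seq (V * R) * N) :=
  [\/ e = ([:: (None, 1); (Some None, - s)], 0), e = ([:: (None, r)], x <* r) |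
      exists2 p, divides p.1 (x <* p.2) & e = eqC p].
have [L LE|sol solE] := cN (V := V) (E := E).
  have /choice [pf pfP] : forall e, exists p : R * R, divides p.1 (x <* p.2) /\
      (e \in L -> [\/ e = ([:: (None, 1); (Some None, - s)], 0),
                     e = ([:: (None, r)], x <* r) | e = eqC p]).
    move=> e; have z : divides (0 : R) (x <* 0) by rewrite ract0; apply/div0.
    have [eL|eL] := EM (e \in L); last by exists (0, 0).
    have [h|h|[p xp h]] := LE _ eL.
    - by exists (0, 0); split=> // _; exact: Or31.
    - by exists (0, 0); split=> // _; exact: Or32.
    - by exists p; split=> // _; exact: Or33.
  (* For [d = k c], the condition [d | x c] says that [x] is in M k + ann c. For [c = k d] it always
     holds, and 1 stands for no condition. *)
  have /choice [kf kfP] : forall p : R * R, exists k,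
      divides p.1 (x <* p.2) -> near_mult k p.2 x /\
      forall u : N, near_mult k p.2 u -> divides p.1 (u <* p.2).
    move=> [d c]; case: (left_chain hR d c) => /= -[k E'].
      by exists k => xd; rewrite /near_mult -E'.
    exists 1 => _; split; first exact/near_mult_div/div1.
    by move=> u _; exists (u <* k); rewrite E' ractM.
  have [|u [[y yE] ur ul]] := near_mult_common
      (l := [seq (kf p, p.2) | p <- map pf L]) _ xsr.
    move=> _ /mapP [p /mapP [e eL ->] ->] /=.
    exact: (kfP _ (pfP e).1).1.
  have /choice [w wE] : forall p, exists w : N, p \in map pf L ->
      u <* p.2 = w <* p.1.
    move=> p; have [pL|pL] := EM (p \in map pf L); last by exists 0.
    have [e eL pE] := mapP pL.
    have [||w wE] := (kfP p _).2 u; last by exists w; rewrite wE.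
      by rewrite pE; exact: (pfP e).1.
    by apply: (ul (kf p, p.2)); exact: map_f.
  exists (fun v => match v with
                   | None => u | Some None => y | Some (Some p) => w p end).
  move=> e eL; have [-> | -> | ->] := (pfP e).2 eL.
  - by rewrite /lincomb !big_cons big_nil addr0 /= ract1 ractN yE subrr.
  - by rewrite /lincomb big_seq1.
  - by rewrite /lincomb !big_cons big_nil addr0 /= ractN wE ?subrr ?map_f.
exists (sol None); split.
- have /= := solE (_, 0) (Or31 _ _ erefl).
  rewrite /lincomb !big_cons big_nil addr0 /= ract1 ractN => /eqP.
  by rewrite subr_eq0 => /eqP ->; exists (sol (Some None)).
- by have /= := solE (_, _) (Or32 _ _ erefl); rewrite /lincomb big_seq1.
- move=> d c dc; have /= := solE (_, 0) (Or33 _ _ (ex_intro2 _ _ (d, c) dc erefl)).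
  rewrite /lincomb !big_cons big_nil addr0 /= ractN => /eqP.
  by rewrite subr_eq0 => /eqP ->; exists (sol (Some (Some (d, c)))).
Qed.

(** Since [u] satisfies every divisibility that [x] does, some endomorphism sends [x] to [u]. It
    fixes [x r = u r], which is nonzero, so it is bijective and its inverse carries [s | u] back to
    [x]. *)
Lemma indecomposable_pp_irreducible : pp_irreducible N.
Proof.
move=> x s r xsr; have [xr0|xr0] := EM (x <* r = 0); [by right | left].
have [u [su ur uC]] := near_mult_compact xsr.
have [|f [fx _]] := @alg_compact_linear _ N N x 0 u 0 hR cN.
  by move=> d a b; rewrite !ract0l !addr0; exact: uC.
have [|k [fk _]] := @fixing_bijective (x <* r) f xr0.
  by rewrite linear_ract fx.
by rewrite -(fk x) fx; exact: linear_div.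
Qed.

(** If [u r = 0], then [a r] divides [v r], and irreducibility gives [v r = 0]. A divisor [s] of [u]
    satisfies [a = k s], so it divides [u - v] and hence [v]. *)
Lemma same_type_sub a (x y : N) :
  divides a (x - y) -> ~ divides a x -> ~ divides a y -> same_type x y.
Proof.
have half (u v : N) : divides a (u - v) -> ~ divides a u -> ~ divides a v ->
    (forall r, u <* r = 0 -> v <* r = 0) /\ (forall s, divides s u -> divides s v).
  move=> auv au av; split=> [r ur|s su].
    have [|//|//] := @indecomposable_pp_irreducible v a r.
    have /(divMr r)/divN := auv.
    by rewrite ractBr ur sub0r opprK.
  case: (left_chain hR s a) => -[k E].
    by case: au; move: su; rewrite E => /divMl.
  have : divides s (u - (u - v)).
    by apply: divB => //; move: auv; rewrite E => /divMl.
  by rewrite opprB addrC subrK.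
move=> axy ax ay; have [h1 h2] := half _ _ axy ax ay.
have [|h3 h4] := half y x _ ay ax; first by rewrite -opprB; exact: divN.
by split=> [r|s]; split; auto.
Qed.

Lemma same_type_mul a (x y : N) :
  x <* a = y <* a -> x <* a <> 0 -> same_type x y.
Proof.
have half (u v : N) : u <* a = v <* a -> u <* a <> 0 ->
    (forall r, u <* r = 0 -> v <* r = 0) /\ (forall s, divides s u -> divides s v).
  move=> uv ua; split=> [r ur|s /(divMr a)].
    have [r' E] := ann_cmp hR ur ua.
    by move: ur; rewrite E !ractM uv.
  by rewrite uv => /indecomposable_pp_irreducible []; rewrite // -uv.
move=> xy xa; have [h1 h2] := half _ _ xy xa.
have [||h3 h4] := half y x; [by [] | by rewrite -xy |].
by split=> [r|s]; split; auto.
Qed.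

(** With [d = a1 a], irreducibility at [x + z k] leaves two cases: [x] and [- z k] agree modulo M
    a1, or they agree after multiplication by [a]. Both force equal types. *)
Let link_left (x z : N) d a b : (exists k, b = k * a) ->
    divides d (x <* a + z <* b) -> ~ divides d (x <* a) -> ~ divides d (z <* b) ->
  exists k, same_type x (z <* k).
Proof.
move=> [k ->] + dx; rewrite ractM -ractDr => du dz.
have [a1 dE] : exists a1, d = a1 * a.
  by apply: (div_cmp hR dx); exists x.
exists (- k); rewrite ractN; set w := z <* k in du dz *.
have a1x : ~ divides a1 x by move=> h; apply: dx; rewrite dE; exact: divMr.
have a1w : ~ divides a1 (- w).
  by move=> /divN; rewrite opprK => h; apply: dz; rewrite dE; exact: divMr.
have : divides a1 (x + w) \/ (x + w) <* a = 0.
  by apply: indecomposable_pp_irreducible; rewrite -dE.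
case=> [a1u|/eqP].
  by apply: (@same_type_sub a1); rewrite ?opprK.
rewrite ractDr addr_eq0 => /eqP xaE; apply: (@same_type_mul a).
  by rewrite ractNl.
by move=> xa; apply: dx; rewrite xa; exact: div_zero.
Qed.

(** If every [d | x a + z b] forced [d | z b], an endomorphism would kill [x] and fix [z], against
    bijectivity. A divisibility violating this is the input of [link_left]. *)
Lemma indecomposable_linked : linked N.
Proof.
move=> x z x0 z0.
have [d [a [b [dxz dz]]]] : exists d a b,
    divides d (x <* a + z <* b) /\ ~ divides d (z <* b).
  apply: contrapT => nex.
  have [d a b dxz|f [fx fz]] := @alg_compact_linear _ N N x z 0 z hR cN.
    rewrite ract0l add0r; apply: contrapT => dz.
    by apply: nex; exists d, a, b.
  have [k [fk _]] := fixing_bijective z0 fz.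
  by apply: x0; rewrite -[x]fk fx linear0.
have dx : ~ divides d (x <* a).
  by move=> dx; apply: dz; have := divB dxz dx; rewrite addrAC subrr add0r.
case: (left_chain hR a b) => kE.
  by have [|k] := link_left kE _ dz dx; [rewrite addrC | exists k; left].
by have [k] := link_left kE dxz dx dz; exists k; right.
Qed.

End Indecomposable.

(** * Indecomposability of the hull of a realization *)

Section HullIndecomposable.
Variables (R : pzRingType) (hR : uniserial R) (Q : rmodType R) (cQ : alg_compact Q).
Variables (I J : set R) (x : Q).
Hypotheses (J0 : J 0) (I1 : ~ I 1) (xIJ : satisfies I J x).
Hypothesis hullx : forall g : {linear Q -> Q}, g x = x -> forall m, g m = 0 -> m = 0.

Let full_type (u : Q) : (forall s r, J s -> ~ I r -> ~ near_mult s r u) ->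
  forall d c, divides d (u <* c) -> divides d (x <* c).
Proof.
have [sx rx nx] := xIJ; move=> hu d c duc.
case: (left_chain hR d c) => -[k E]; last first.
  by rewrite E ractM; exists (x <* k).
have [Jk|nJk] := EM (J k); last by rewrite E; exact/divMr/sx.
have [Ic|nIc] := EM (I c); first by rewrite rx //; exact: div_zero.
by case: (hu _ _ Jk nIc); rewrite /near_mult -E.
Qed.

(** If [p x] avoids every M s + ann r with [s] in J and [r] outside I, an endomorphism takes it back
    to [x], so [p] is injective. If [p1 x] and [p2 x] both fail to avoid them, [x] lies in the sum
    of two such subgroups, which is again one of them. *)
Lemma hull_split (p1 p2 : {linear Q -> Q}) : (forall m, p1 m + p2 m = m) ->
  (forall m, p1 m = 0 -> m = 0) \/ (forall m, p2 m = 0 -> m = 0).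
Proof.
move=> p12; have [_ _ nx] := xIJ.
have one (p : {linear Q -> Q}) :
    (forall s r, J s -> ~ I r -> ~ near_mult s r (p x)) ->
    forall m, p m = 0 -> m = 0.
  move=> hp m pm.
  have [d a b|G [Gx _]] := @alg_compact_linear _ Q Q (p x) 0 x 0 hR cQ.
    by rewrite !ract0l !addr0; exact: full_type.
  apply: (hullx (g := G \o p : {linear Q -> Q})) => //=.
  by rewrite pm linear0.
apply: contrapT => /not_orP [n1 n2].
have bad (p : {linear Q -> Q}) : ~ (forall m, p m = 0 -> m = 0) ->
    exists s r, [/\ J s, ~ I r & near_mult s r (p x)].
  move=> np; apply: contrapT => nex; apply: np; apply: one => s r Js Ir sr.
  by apply: nex; exists s, r.
have [s1 [r1 [Js1 Ir1 h1]]] := bad _ n1; have [s2 [r2 [Js2 Ir2 h2]]] := bad _ n2.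
have [s [sor s1E s2E]] := left_gen_ex hR s1 s2.
have [r [ror r1E r2E]] : exists r, right_min r1 r2 r.
  have refl c : exists h, c = c * h by exists 1; rewrite mulr1.
  by case: (right_chain hR r1 r2) => -[h E]; [exists r1 | exists r2]; split;
    by [left | right | exists h | exact: refl].
apply: (nx s r); [by case: sor => -> | by case: ror => -> |].
rewrite -[x]p12; apply: (@near_multD _ _ s r).
  exact: near_mult_mono h1.
exact: near_mult_mono h2.
Qed.

Lemma hull_indecomposable : indecomposable Q.
Proof.
have [_ _ nx] := xIJ; split.
  move=> tQ; apply: (nx 0 1 J0 I1).
  by rewrite (tQ (x <* 1)); exact: div_zero.
move=> A B [f [g fg gf]].
have [a b|a r|g' g'E] := @linearP_ex _ _ _ g.
- by apply: (can_inj fg); rewrite linearD !gf.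
- by apply: (can_inj fg); rewrite linear_ract !gf.
have [m m'|m r|p1 p1E] := @linearP_ex _ _ _ (fun m => g' ((f m).1, 0)).
- rewrite linearD -(linearD g'); apply: (congr1 g').
  by apply: injective_projections; rewrite /= ?addr0.
- rewrite linear_ract -(linear_ract g'); apply: (congr1 g').
  by apply: injective_projections; rewrite //= ?ract0l ?scaler0.
have [m m'|m r|p2 p2E] := @linearP_ex _ _ _ (fun m => g' (0, (f m).2)).
- rewrite linearD -(linearD g'); apply: (congr1 g').
  by apply: injective_projections; rewrite /= ?addr0.
- rewrite linear_ract -(linear_ract g'); apply: (congr1 g').
  by apply: injective_projections; rewrite //= ?ract0l ?scaler0.
have [m|h|h] := hull_split (p1 := p1) (p2 := p2).
- rewrite p1E p2E -linearD g'E -[RHS]fg; apply: (congr1 g).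
  by apply: injective_projections; rewrite /= ?addr0 ?add0r.
- right=> b; have : g' (0, b) = 0.
    by apply: h; rewrite p1E (g'E (0, b)) gf; exact: linear0.
  by rewrite g'E => /(congr1 f); rewrite gf linear0 => -[].
- left=> a; have : g' (a, 0) = 0.
    by apply: h; rewrite p2E (g'E (a, 0)) gf; exact: linear0.
  by rewrite g'E => /(congr1 f); rewrite gf linear0 => -[].
Qed.

End HullIndecomposable.

(** * Realizing a finitely satisfied pair *)

Section Realize.
Variables (R : pzRingType) (hR : uniserial R) (N : rmodType R).
Hypothesis irrN : pp_irreducible N.
Variables (I J : set R).
Hypotheses (I0 : I 0) (J0 : J 0) (I1 : ~ I 1) (J1 : ~ J 1).
Hypothesis fsIJ : forall s r t b, ~ J s -> ~ I r -> J t -> I b ->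
  exists y : N, [/\ divides s y, y <* r <> 0, ~ divides t y & y <* b = 0].

(** A finite part of the description J^*/I, reduced to four parameters; demands index the reduced
    power. *)
Record demand := Demand {
  d_s : R; d_r : R; d_t : R; d_b : R;
  d_sP : ~ J d_s; d_rP : ~ I d_r; d_tP : J d_t; d_bP : I d_b }.

Definition weaker (l m : demand) :=
  [/\ exists k, d_s m = k * d_s l, exists k, d_r m = d_r l * k,
      exists k, d_t l = k * d_t m & exists k, d_b l = d_b m * k].

Lemma weaker_trans l m n : weaker l m -> weaker m n -> weaker l n.
Proof.
move=> [[k1 h1] [k2 h2] [k3 h3] [k4 h4]] [[i1 g1] [i2 g2] [i3 g3] [i4 g4]].
split; [exists (i1 * k1) | exists (k2 * i2) | exists (k3 * i3) | exists (i4 * k4)].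
- by rewrite g1 h1 mulrA.
- by rewrite g2 h2 mulrA.
- by rewrite h3 g3 mulrA.
- by rewrite h4 g4 mulrA.
Qed.

Lemma weaker_directed l m : exists n, weaker l n /\ weaker m n.
Proof.
have refll c : exists h : R, c = h * c by exists 1; rewrite mul1r.
have reflr c : exists h : R, c = c * h by exists 1; rewrite mulr1.
have [s [sP ls ms]] : exists s, [/\ ~ J s, exists k, s = k * d_s l &
    exists k, s = k * d_s m].
  case: (left_chain hR (d_s l) (d_s m)) => h.
    by exists (d_s l); split=> //; exact: d_sP.
  by exists (d_s m); split=> //; exact: d_sP.
have [r [rP lr mr]] : exists r, [/\ ~ I r, exists k, r = d_r l * k &
    exists k, r = d_r m * k].
  case: (right_chain hR (d_r l) (d_r m)) => h.
    by exists (d_r l); split=> //; exact: d_rP.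
  by exists (d_r m); split=> //; exact: d_rP.
have [t [tP lt mt]] : exists t, [/\ J t, exists k, d_t l = k * t &
    exists k, d_t m = k * t].
  case: (left_chain hR (d_t l) (d_t m)) => h.
    by exists (d_t m); split=> //; exact: d_tP.
  by exists (d_t l); split=> //; exact: d_tP.
have [b [bP lb mb]] : exists b, [/\ I b, exists k, d_b l = b * k &
    exists k, d_b m = b * k].
  case: (right_chain hR (d_b l) (d_b m)) => h.
    by exists (d_b m); split=> //; exact: d_bP.
  by exists (d_b l); split=> //; exact: d_bP.
by exists (Demand sP rP tP bP).
Qed.

(* The functions [demand -> N] modulo those that eventually vanish form a
   reduced power of [N]; the bidual takes the quotient implicitly. *)
Definition eventually_zero (h : demand -> N) :=
  exists l, forall m, weaker l m -> h m = 0.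

Lemma eventually_zeroB h h' :
  eventually_zero h -> eventually_zero h' -> eventually_zero (h - h').
Proof.
move=> [l lP] [m mP]; have [n [ln mn]] := weaker_directed l m.
exists n => p np; rewrite -[LHS]/(h p - h' p) lP ?mP ?subrr //.
  exact: weaker_trans mn np.
exact: weaker_trans ln np.
Qed.

Lemma eventually_zero0 : eventually_zero 0.
Proof. by exists (Demand J1 I1 J0 I0). Qed.

Lemma eventually_zeroM (h : (demand -> N) : rmodType R) r :
  eventually_zero h -> eventually_zero (h <* r).
Proof.
by move=> [l lP]; exists l => m lm; rewrite -[LHS]/(h m <* r) lP ?ract0l.
Qed.

Lemma realize : exists Q : rmodType R,
  [/\ indecomposable Q, alg_compact Q & exists x : Q, satisfies I J x].
Proof.
pose Z := Submodule eventually_zero0 eventually_zeroB eventually_zeroM.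
have /choice [y yP] : forall l, exists y : N, [/\ divides (d_s l) y,
    y <* d_r l <> 0, ~ divides (d_t l) y & y <* d_b l = 0].
  by move=> l; apply: fsIJ; [exact: d_sP | exact: d_rP | exact: d_tP | exact: d_bP].
pose E : rmodType R := bidual Z.
have cE : alg_compact E := @bidual_alg_compact _ _ Z.
have killZ h : Z h -> to_bidual Z h = 0.
  by move=> Zh; apply: bidual_ext => f; exact: charZ.
have eqZ (h h' : (demand -> N) : rmodType R) : Z (h - h') ->
    to_bidual Z h = to_bidual Z h'.
  by move=> /killZ hh'; rewrite -[h](subrK h') to_bidualD hh' add0r.
pose x : E := to_bidual Z y.
have xIJ : satisfies I J x.
  split=> [s Js|r Ir|s r Js Ir [w wE]].
  - have /choice [h hP] : forall l, exists z : N, divides s (y l) -> y l = z <* s.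
      move=> l; have [[z zE]|nd] := EM (divides s (y l)); first by exists z.
      by exists 0 => /nd.
    exists (to_bidual Z h); rewrite -to_bidual_ract; apply: eqZ.
    exists (Demand Js I1 J0 I0) => m [[k kE] _ _ _] /=.
    rewrite -[LHS]/(y m - h m <* s) -hP ?subrr //.
    by have [+ _ _ _] := yP m; rewrite kE => /divMl.
  - rewrite -to_bidual_ract; apply: killZ.
    exists (Demand J1 I1 J0 Ir) => m [_ _ _ [k /= kE]].
    rewrite -[LHS]/(y m <* r) kE ractM.
    by have [_ _ _ ->] := yP m; rewrite ract0l.
  (* Purity brings a divisor from the bidual back to the reduced power: eventually [s r] divides
     [y m <* r] in N itself, where irreducibility applies. *)
  - pose L := [:: ([:: (tt, s * r)], y <* r : ((demand -> N) : rmodType R))].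
    have [|h /(_ _ (mem_head _ _))] := bidual_pure (Z := Z) (L := L).
      exists (fun=> w) => e; rewrite inE => /eqP -> /=.
      by rewrite /lincomb big_seq1 to_bidual_ract.
    rewrite /lincomb big_seq1 /= => -[l lP].
    have [m [lm [_ [k1 /= rE] [k2 /= tE] _]]] := weaker_directed l (Demand J1 Ir Js I0).
    have := lP m lm.
    rewrite -[LHS]/(h tt m <* (s * r) - y m <* r) => /eqP.
    rewrite subr_eq0 => /eqP /esym ymr.
    have [_ ry ty _] := yP m.
    have [|sy|ry0] := irrN (x := y m) (s := s) (r := r); first by exists (h tt m).
      by apply: ty; move: sy; rewrite tE => /divMl.
    by apply: ry; rewrite rE ractM ry0 ract0l.
have [e [ee ex eP]] := hull_idempotent cE x.
have [i iE] := fixed_incl e; have [p pE] := fixed_proj ee.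
have ip m : i (p m) = e m by rewrite iE pE.
have pi : cancel i p.
  move=> [m me]; apply: val_inj; rewrite /= pE iE /=; exact/eqP.
exists (fixed e : rmodType R).
have cQ : alg_compact (fixed e : rmodType R) := alg_compact_retract pi cE.
have [sx rx nx] := xIJ; have ix : i (p x) = x by rewrite ip.
have pxIJ : satisfies I J (p x).
  split=> [s /sx /(linear_div p) //|r /rx|s r Js Ir /(linear_div i)].
    by rewrite -linear_ract => ->; rewrite linear0.
  by rewrite linear_ract ix; exact: nx.
split=> //; last by exists (p x).
apply: (hull_indecomposable hR cQ J0 I1 pxIJ) => g gx m gm.
have [|k kE] := eP (i \o g \o p : {linear E -> E}); first by rewrite /= gx.
apply: (can_inj pi); rewrite linear0.
have iem : e (i m) = i m by rewrite -ip pi.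
by have := kE (i m); rewrite /= iem pi gm !linear0 => <-.
Qed.

End Realize.

(** * Basic open sets *)

Section PPFormulas.
Variables (R : pzRingType) (hR : uniserial R).

Lemma pp_congruences (phi : pp_formula R 1) : exists l : seq (R * R),
  forall (M : rmodType R) (x : M), pp_sol phi (fun=> x) <->
    forall p, p \in l -> divides p.1 (x <* p.2).
Proof.
pose b := pp_bound phi; pose A := pp_matrix phi.
pose V := option 'I_b.
pose eqn j : seq (V * R) := [seq (Some i, A (lshift 1 i) j) | i <- enum 'I_b] ++
  [:: (None, A (rshift b ord0) j)].
pose S := [seq (0 : R, eqn j) | j <- enum 'I_(pp_eqs phi)].
have [S' [S'v S'P]] := elim_vars hR [seq Some i | i <- enum 'I_b] S.
exists [seq (c.1, coef None c.2) | c <- S'] => M x.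
pose sol0 (v : V) := x.
have S'E c : c \in S' -> lincomb sol0 c.2 = x <* coef None c.2.
  move=> cS; rewrite (@lincomb_coef _ _ _ _ [:: None]) ?big_seq1 //.
  move=> u uc; have /S'v [+ _] : u \in vars S' by apply/flatten_mapP; exists c.
  by case: u uc => // i _ /negP []; apply: map_f; rewrite mem_enum.
have eqnE (sol : V -> M) j : lincomb sol (eqn j) =
    \sum_(i < b) sol (Some i) <* A (lshift 1 i) j +
    \sum_(k < 1) sol None <* A (rshift b k) j.
  by rewrite /eqn lincomb_cat /lincomb big_map big_enum big_seq1 big_ord1.
split=> [[y yE] _ /mapP [c cS ->]|h].
  rewrite /= -S'E //; suff : forall c, c \in S' -> congr_sol sol0 c by apply.
  apply/S'P; exists (fun v => if v is Some i then y i else x).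
    by case=> // i; rewrite inE /= => /negP []; apply: map_f; rewrite mem_enum.
  move=> _ /mapP [j _ ->]; rewrite /congr_sol /=; apply/div0.
  by rewrite eqnE; exact: yE.
have /S'P [sol solx solS] : forall c, c \in S' -> congr_sol sol0 c.
  by move=> c cS; rewrite /congr_sol S'E //; apply: (h (c.1, _)); exact: map_f.
exists (fun i => sol (Some i)) => j.
have : congr_sol sol (0, eqn j) by apply: solS; apply: map_f; rewrite mem_enum.
rewrite /congr_sol /= => /div0; rewrite eqnE -solx //.
by rewrite inE; apply/negP => /mapP [].
Qed.

(** By irreducibility each [h c | x c] has a reason [h | x] or [x c = 0], and the chains merge
    finitely many reasons into one divisor and one annihilating element. *)
Lemma pp_irreducible_congruences (M : rmodType R) (x : M) (l : seq (R * R)) :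
    pp_irreducible M -> (forall p, p \in l -> divides p.1 (x <* p.2)) ->
  exists s b, [/\ divides s x, x <* b = 0 &
    forall (M' : rmodType R) (y : M'), divides s y -> y <* b = 0 ->
      forall p, p \in l -> divides p.1 (y <* p.2)].
Proof.
move=> irrM; elim: l => [|[d c] l IH] hl.
  by exists 1, 0; split=> //; [exact: div1 | exact: ract0].
have [p pl|s [b [sx xb slP]]] := IH; first by apply: hl; rewrite inE pl orbT.
have := hl _ (mem_head _ _); rewrite /=.
case: (left_chain hR d c) => -[h E]; last first.
  move=> _; exists s, b; split=> // M' y sy yb p.
  rewrite inE => /orP[/eqP->|/slP]; last exact.
  by rewrite /= E ractM; exists (y <* h).
rewrite E => /irrM [hx|xc].
  have [s' [s'x [k1 s'E] [k2 s'E']]] : exists s', [/\ divides s' x,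
      exists k, s' = k * s & exists k, s' = k * h].
    case: (left_chain hR s h) => k; [exists s | exists h]; split=> //;
      by exists 1; rewrite mul1r.
  exists s', b; split=> // M' y s'y yb p.
  rewrite inE => /orP[/eqP->|].
    by rewrite /=; apply: divMr; move: s'y; rewrite s'E' => /divMl.
  by apply: slP => //; move: s'y; rewrite s'E => /divMl.
have [b' [xb' [k1 b'E] [k2 b'E']]] : exists b', [/\ x <* b' = 0,
    exists k, b = b' * k & exists k, c = b' * k].
  case: (right_chain hR b c) => k; [exists c | exists b]; split=> //;
    by exists 1; rewrite mulr1.
exists s, b'; split=> // M' y sy yb' p.
rewrite inE => /orP[/eqP->|].
  by rewrite /= b'E' [y <* _]ractM yb' ract0l; exact: div_zero.
by apply: slP => //; rewrite b'E ractM yb' ract0l.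
Qed.

Definition pp_pair_open (phi psi : pp_formula R 1) (M : rmodType R) :=
  exists x : M, pp_sol phi (fun=> x) /\ ~ pp_sol psi (fun=> x).

(** Failure of [psi] is failure of a single [k u | x u], that is, [x u <> 0] and [k] not dividing
    [x]. With the divisor and annihilating element that imply [phi], this is one instance of
    [approx]. *)
Lemma approx_pp_pair_open (N M : rmodType R) phi psi :
  pp_irreducible N -> pp_irreducible M -> (forall x : N, x <> 0 -> approx M x) ->
  pp_pair_open phi psi N -> pp_pair_open phi psi M.
Proof.
move=> irrN irrM ax [x]; have [l1 l1P] := pp_congruences phi.
have [l2 l2P] := pp_congruences psi.
rewrite !l1P !l2P => -[h1 /existsNP [[t u]] /not_implyP [l2t /= ntxu]].
have [k tE] : exists k, t = k * u by apply: (div_cmp hR ntxu); exists x.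
have xu : x <* u <> 0 by move=> xu; apply: ntxu; rewrite xu; exact: div_zero.
have nkx : ~ divides k x by move=> kx; apply: ntxu; rewrite tE; exact: divMr.
have [s [b [sx xb sbP]]] := pp_irreducible_congruences irrN h1.
have [y [sy yu nky yb]] := ax x (ract_neq0 xu) s u k b sx xu nkx xb.
exists y; rewrite l1P l2P; split; first exact: sbP.
by move=> /(_ _ l2t) /=; rewrite tE => /irrM [].
Qed.

Lemma pp_pair_open_iso (N M : rmodType R) phi psi : mod_iso N M ->
  pp_pair_open phi psi M -> pp_pair_open phi psi N.
Proof.
move=> [f [g fg gf]] [x]; have [l1 l1P] := pp_congruences phi.
have [l2 l2P] := pp_congruences psi.
have gdiv d c : divides d (x <* c) <-> divides d (g x <* c).
  have [a b|a r|g' g'E] := @linearP_ex _ _ _ g.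
  - by apply: (can_inj fg); rewrite linearD !gf.
  - by apply: (can_inj fg); rewrite linear_ract !gf.
  split=> [/(linear_div g')|/(linear_div f)]; rewrite linear_ract ?g'E //.
  by rewrite gf.
rewrite l1P l2P => -[h1 h2]; exists (g x); rewrite l1P l2P; split.
  by move=> p pl; apply/gdiv/h1.
by move=> h; apply: h2 => p pl; apply/gdiv/h.
Qed.

Lemma zg_basicE phi psi (p : Zg R) (N : rmodType R) : zg_class p = mod_iso N ->
  zg_basic phi psi p <-> pp_pair_open phi psi N.
Proof.
move=> pN; rewrite /zg_basic pN.
have const (M : rmodType R) (x : 'I_1 -> M) : x = (fun=> x ord0).
  by apply: funext => i; rewrite ord1.
split=> [[M NM [_ /existsNP [x /not_implyP [phix npsix]]]]|[x [phix npsix]]].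
  apply: (pp_pair_open_iso NM); exists (x ord0); rewrite -const; split=> //.
  by move=> psix; apply: npsix.
exists N; first by exists idfun; exists idfun.
split; first by move=> ? [].
by move=> /(_ _ phix) [].
Qed.

Lemma basic_indistinguishable (p q : Zg R) :
  (forall phi psi, zg_basic phi psi p <-> zg_basic phi psi q) ->
  indistinguishable p q.
Proof.
move=> pq U Uopen; split=> [/Uopen|/Uopen] [phi [psi [pphi phiU]]];
  by apply: phiU; apply/pq.
Qed.

End PPFormulas.

(** * The three families *)

Section Ideals.
Variables (R : pzRingType) (hR : uniserial R).

Lemma satisfies_is_pair (I J : set R) (M : rmodType R) (x : M) :
    I 0 -> J 0 -> ~ I 1 -> ~ J 1 -> satisfies I J x -> is_pair I J.
Proof.
move=> I0 J0 I1 J1 [sx rx nx].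
have IE r : I r <-> x <* r = 0.
  split=> [/rx //|xr]; apply: contrapT => Ir; apply: (nx 0 r J0 Ir).
  by rewrite xr; exact: div_zero.
have JE s : J s <-> ~ divides s x.
  split=> [Js sx'|nsx]; last by apply: contrapT => /sx.
  by apply: (nx s 1 Js I1); exact: divMr.
split.
- split; last by move=> a r; rewrite !IE ractM => ->; exact: ract0l.
  split=> // a b; rewrite !IE ractDl ractN => -> ->; exact: subr0.
- by move=> IT; apply: I1; rewrite IT.
- split; last by move=> r a; rewrite !JE => na /divMl.
  split=> // a b; rewrite !JE => na nb; apply: (ndivD hR na) => -[y yE].
  by apply: nb; exists (- y); rewrite ractNl -ractN.
- by move=> JT; apply: J1; rewrite JT.
Qed.

Section Module.
Variables (N : rmodType R) (x0 : N).
Hypothesis x0_neq0 : x0 <> 0.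

Lemma nontriv_unit a u : inverses a u -> forall z : N, z <* a = 0 -> z = 0.
Proof. by move=> [au _] z za; rewrite -[z]ract1 -au ractM za ract0l. Qed.

Lemma annih_two_sided : two_sided_ideal (annih N).
Proof.
have add : additive_subgroup (annih N).
  split=> [x|a b Aa Ab x]; first exact: ract0.
  by rewrite ractDl ractN Aa Ab subrr.
split; split=> //; last by move=> r a Aa x; rewrite ractM Aa.
by move=> a r Aa x; rewrite ractM Aa ract0l.
Qed.

Lemma annih1 : ~ annih N 1.
Proof. by move=> /(_ x0); rewrite ract1. Qed.

Lemma torsion1 : ~ torsion N 1.
Proof. by case=> z z0; rewrite ract1. Qed.

Lemma nondiv1 : ~ nondiv N 1.
Proof. by case=> z; apply; exact: div1. Qed.

(** Left multiplication by [r] is the delicate point: units preserve the set, and otherwise [1 + r]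
    is a unit and [r a = (1 + r) a - a]. *)
Lemma torsion_completely_prime : completely_prime (torsion N).
Proof.
have T0 : torsion N 0 by exists x0 => //; exact: ract0.
have TM a r : torsion N a -> torsion N (a * r).
  by move=> [z z0 za]; exists z => //; rewrite ractM za ract0l.
have TB a b : torsion N a -> torsion N b -> torsion N (a - b).
  move=> Ta Tb; case: (right_chain hR a b) => -[k E].
    by have := TM _ (k - 1) Tb; rewrite mulrBr mulr1 -E.
  by have := TM _ (1 - k) Ta; rewrite mulrBr mulr1 -E.
have TU a u r : inverses a u -> torsion N r -> torsion N (a * r).
  move=> au [z z0 zr]; exists (z <* u); first by move=> /(nontriv_unit (conj au.2 au.1)).
  by rewrite -ractM mulrA au.2 mul1r.
split.
- split; first by split; [split|].
  split=> // r a Ta; case: (local_ring hR r) => -[u ru]; first exact: TU ru Ta.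
  by have := TB _ _ (TU _ _ _ ru Ta) Ta; rewrite mulrDl mul1r addrAC subrr add0r.
- by move=> TT; apply: torsion1; rewrite TT.
- move=> a b [z z0 zab]; have [za|za] := EM (z <* a = 0); first by left; exists z.
  by right; exists (z <* a); rewrite // -ractM.
Qed.

Lemma nondiv_completely_prime : completely_prime (nondiv N).
Proof.
have D0 : nondiv N 0 by exists x0 => /div0.
have DM r a : nondiv N a -> nondiv N (r * a).
  by move=> [z za]; exists z => /divMl.
have DB a b : nondiv N a -> nondiv N b -> nondiv N (a - b).
  move=> Da Db; case: (left_chain hR a b) => -[k E].
    by have := DM (k - 1) _ Db; rewrite mulrBl mul1r -E.
  by have := DM (1 - k) _ Da; rewrite mulrBl mul1r -E.
have DU a u r : inverses a u -> nondiv N r -> nondiv N (r * a).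
  move=> au [z zr]; exists (z <* a) => /(divMr u).
  by rewrite -ractM -mulrA au.1 mulr1 ract1.
split.
- split; last by split; [split|].
  split=> // a r Da; case: (local_ring hR r) => -[u ru]; first exact: DU ru Da.
  by have := DB _ _ (DU _ _ _ ru Da) Da; rewrite mulrDr mulr1 addrAC subrr add0r.
- by move=> DT; apply: nondiv1; rewrite DT.
- move=> a b [z zab]; have [[y yE]|nzb] := EM (divides b z); last first.
    by right; exists z.
  by left; exists y => ya; apply: zab; rewrite yE; exact: divMr.
Qed.

End Module.
End Ideals.

(** * Pairs formed by A and one of P, Q *)

Section Cases.
Variables (R : pzRingType) (hR : uniserial R) (N : rmodType R).
Hypotheses (irrN : pp_irreducible N) (linkN : linked N).
Variable x0 : N.
Hypothesis x0_neq0 : x0 <> 0.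

Local Notation A := (annih N).
Local Notation P := (torsion N).
Local Notation Q := (nondiv N).

Definition realized_alike (I J : set R) := exists M : rmodType R,
  [/\ indecomposable M, alg_compact M, exists x : M, satisfies I J x,
      forall x : M, x <> 0 -> approx N x & forall x : N, x <> 0 -> approx M x].

(** Finite satisfiability of the pair in N gives one direction of [approx] at the realizing element,
    the last hypothesis gives the other at one element; [approx_link] spreads both to all nonzero
    elements. *)
Lemma realize_alike (I J : set R) : I 0 -> J 0 -> ~ I 1 -> ~ J 1 ->
    (forall s r t b, ~ J s -> ~ I r -> J t -> I b -> exists y : N,
       [/\ divides s y, y <* r <> 0, ~ divides t y & y <* b = 0]) ->
    (forall (M : rmodType R) (x : M), pp_irreducible M -> linked M -> x <> 0 ->
       (forall r, I r <-> x <* r = 0) -> (forall s, J s <-> ~ divides s x) ->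
       exists2 u : N, u <> 0 & approx M u) ->
  realized_alike I J.
Proof.
move=> I0 J0 I1 J1 fs hu.
have [M [iM cM [x xIJ]]] := realize hR irrN I0 J0 I1 J1 fs.
have irrM := indecomposable_pp_irreducible hR iM cM.
have linkM := indecomposable_linked hR iM cM.
have [sx rx nx] := xIJ.
have IE r : I r <-> x <* r = 0.
  split=> [/rx //|xr]; apply: contrapT => Ir; apply: (nx 0 r J0 Ir).
  by rewrite xr; exact: div_zero.
have JE s : J s <-> ~ divides s x.
  split=> [Js sx'|nsx]; last by apply: contrapT => /sx.
  by apply: (nx s 1 Js I1); exact: divMr.
have xn0 : x <> 0 by move=> x0'; apply: I1; apply/IE; rewrite ract1.
have [u u0 au] := hu M x irrM linkM xn0 IE JE.
exists M; split=> //; first by exists x.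
  move=> z z0; apply: (approx_link hR irrN irrM linkM xn0 _ z0).
  move=> s r t b sx' xr tx xb; apply: fs.
  - by move/JE.
  - by move/IE.
  - exact/JE.
  - exact/IE.
by move=> z z0; exact: (approx_link hR irrM irrN linkN u0 au z0).
Qed.

(** Write the realizing element as [x = y c], possible because [c] is outside A. As [t c] is in A,
    [t] cannot divide [y], and [y g = x p = 0]: the factorizations of [g] reproduce in M every
    witness of [covers]. *)
Lemma realize_torsion_annih :
    (forall t g, covers N t g -> exists c, [/\ ~ A c, A (t * c) &
       exists2 p, P p & g = c * p]) ->
  realized_alike P A.
Proof.
move=> hcov; apply: realize_alike.
- by exists x0 => //; exact: ract0.
- by move=> x; exact: ract0.
- exact: torsion1.
- exact: (annih1 x0_neq0).
- move=> s r t b /existsNP [m ms] nPr At [w w0 wb].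
  have [||||||y [yb y1 sy _]] := join hR irrN linkN (w := w) (z := m <* s)
    (b := b) (r := 1) (d := s) (t := 0); rewrite ?ract1 ?div0 //.
    by exists m.
  rewrite ract1 in y1; exists y; split=> //.
    by move=> yr; apply: nPr; exists y.
  by case=> v yE; apply: y1; rewrite yE At.
- move=> M x irrM linkM xn0 IE JE; exists x0 => //.
  have cov t b : covers N t b -> covers M t b.
    move=> /hcov [c [nAc Atc [p Pp ->]]].
    have [y yE] : divides c x by apply: contrapT => /JE.
    exists y; split; last by rewrite ractM -yE; exact/IE.
    by move=> ty; move/JE: Atc; apply; rewrite yE; exact: divMr.
  apply: approx_of_covers => //.
  + move=> s As; apply: contrapT => /JE/contrapT [y yE].
    by apply: xn0; rewrite yE As.
  + by move=> r /IE xr; exists x.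
  + move=> s [z sz]; have [|y [sy _]] := cov s 0; last by exists y.
    by exists z; split=> //; exact: ract0.
  + by move=> t b tx xb; apply: cov; exists x0.
Qed.

Lemma realize_annih_nondiv :
    (forall t g, covers N t g -> exists c, [/\ ~ A c, A (c * g) &
       exists2 q, Q q & t = q * c]) ->
  realized_alike A Q.
Proof.
move=> hcov; apply: realize_alike.
- by move=> x; exact: ract0.
- by exists x0 => /div0.
- exact: (annih1 x0_neq0).
- exact: nondiv1.
- move=> s r t b nQs /existsNP [m mr] [n tn] Ab.
  have sdiv (y : N) : divides s y by apply: contrapT => sy; apply: nQs; exists y.
  have [tm|tm] := EM (divides t m); last by exists m.
  have [nr|nr] := EM (n <* r = 0); last by exists n.
  exists (m + n); split=> //; first by rewrite ractDr nr addr0.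
  by move=> /divB /(_ tm); rewrite addrAC subrr add0r.
- move=> M x irrM linkM xn0 IE JE; exists x0 => //.
  have cov t b : covers N t b -> covers M t b.
    move=> /hcov [c [nAc Acb [q Qq ->]]].
    have xc : x <* c <> 0 by move/IE.
    exists (x <* c); split; last by rewrite -ractM; exact/IE.
    by move=> /irrM [|//]; exact/JE.
  apply: approx_of_covers => //.
  + by move=> s As; apply/IE/As.
  + move=> r [z z0 zr]; have [|y [sy yr]] := cov 0 r.
      by exists z; split=> //; move/div0.
    by exists y => // y0; apply/sy/div0.
  + by move=> s /JE; exists x.
  + by move=> t b tx xb; apply: cov; exists x0.
Qed.

End Cases.

(** * Recovering P from the ideals attached to an element of P *)

Section CompletelyPrime.
Variables (R : pzRingType) (hR : uniserial R) (P : set R).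
Hypothesis cpP : completely_prime P.

Lemma prime_unit m u : P m -> inverses m u -> False.
Proof.
have [[[_ PM] _] Pproper _] := cpP; move=> Pm [mu _]; apply: Pproper.
apply/seteqP; split=> // r _; rewrite -[r]mul1r -mu -mulrA.
exact: PM.
Qed.

Lemma prime_add1 m : P m -> exists u, inverses (1 + m) u.
Proof. by move=> Pm; case: (local_ring hR m) => // -[u /(prime_unit Pm)]. Qed.

Lemma primeN m : P m -> P (- m).
Proof.
have [[[[P0 PB] _] _] _ _] := cpP.
by move=> Pm; rewrite -[- m]add0r; exact: PB.
Qed.

Lemma prime_absorb_r b m : P m -> b = b * m -> b = 0.
Proof.
move=> /primeN/prime_add1 [u [mu _]] bm.
by rewrite -[b]mulr1 -mu mulrA mulrDr mulr1 mulrN -bm subrr mul0r.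
Qed.

Lemma prime_absorb_l b m : P m -> b = m * b -> b = 0.
Proof.
move=> /primeN/prime_add1 [u [_ um]] bm.
by rewrite -[b]mul1r -um -mulrA mulrDl mul1r mulNr -bm subrr mulr0.
Qed.

(** If [b = c r], then [c] works, since [b = b p] with [p] in P forces [b = 0]. What remains is
    [r = k b] with [1 + k] invertible, where 1 or the inverse of [1 + k] works. *)
Lemma right_Ib_sharp b r : P b -> b <> 0 -> P r ->
  exists2 c, ~ right_Ib P b c & right_Ib P b (c * r).
Proof.
have [[[_ PR] [_ PL]] _ _] := cpP; move=> Pb b0 Pr.
suff [c [p Pp bE] hc] : exists2 c, exists2 p, P p & b = c * p &
    forall p, P p -> b <> c * r * p.
  by exists c; [apply; exists p | case=> p' /hc].
have gen c : b = c * r ->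
    exists2 c, exists2 p, P p & b = c * p & forall p, P p -> b <> c * r * p.
  move=> bE; exists c; first by exists r.
  by move=> p Pp; rewrite -bE => /(prime_absorb_r Pp).
case: (left_chain hR b r) => -[k kE]; first exact: gen kE.
case: (local_ring hR k) => -[u [ku uk]].
  by apply: (gen u); rewrite kE mulrA uk mul1r.
have [[p Pp bE]|nb] := EM (exists2 p, P p & b = k * b * p); last first.
  exists 1; first by exists b; rewrite ?mul1r.
  by move=> p Pp; rewrite mul1r kE => bE; apply: nb; exists p.
(* Here [b = k b p], hence [u (k b) (1 + p) = b]: so [u r] is [b] times a unit, and [b = u r p']
   would put [b] in b P. *)
exists u; first by exists ((1 + k) * b); [exact: PL | rewrite mulrA uk mul1r].
move=> p' Pp' bE'; have [v [pv _]] := prime_add1 Pp.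
have ukb : u * (k * b) = b * v.
  have : u * (k * b) * (1 + p) = b.
    rewrite mulrDr mulr1 -(mulrA u (k * b) p) -bE -mulrDr.
    by rewrite -{2}[b]mul1r -mulrDl addrC mulrA uk mul1r.
  by move=> {2}<-; rewrite -mulrA pv mulr1.
apply: b0; apply: (@prime_absorb_r b (v * p')); first exact: PL.
by rewrite mulrA -ukb -kE.
Qed.

Lemma left_Ib_sharp b r : P b -> b <> 0 -> P r ->
  exists2 c, ~ left_Ib P b c & left_Ib P b (r * c).
Proof.
have [[[_ PR] [_ PL]] _ _] := cpP; move=> Pb b0 Pr.
suff [c [p Pp bE] hc] : exists2 c, exists2 p, P p & b = p * c &
    forall p, P p -> b <> p * (r * c).
  by exists c; [apply; exists p | case=> p' /hc].
have gen c : b = r * c ->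
    exists2 c, exists2 p, P p & b = p * c & forall p, P p -> b <> p * (r * c).
  move=> bE; exists c; first by exists r.
  by move=> p Pp; rewrite -bE => /(prime_absorb_l Pp).
case: (right_chain hR b r) => -[k kE]; first exact: gen kE.
case: (local_ring hR k) => -[u [ku uk]].
  by apply: (gen u); rewrite kE -mulrA ku mulr1.
have [[p Pp bE]|nb] := EM (exists2 p, P p & b = p * (b * k)); last first.
  exists 1; first by exists b; rewrite ?mulr1.
  by move=> p Pp; rewrite mulr1 kE => bE; apply: nb; exists p.
exists u; first by exists (b * (1 + k)); [exact: PR | rewrite -mulrA ku mulr1].
move=> p' Pp' bE'; have [v [_ vp]] := prime_add1 Pp.
have ukb : b * k * u = v * b.
  have : (1 + p) * (b * k * u) = b.
    rewrite mulrDl mul1r [p * (b * k * u)]mulrA -bE -mulrDl.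
    by rewrite -{2}[b]mulr1 -mulrDr addrC -mulrA ku mulr1.
  by move=> {2}<-; rewrite mulrA vp mul1r.
apply: b0; apply: (@prime_absorb_l b (p' * v)); first exact: PR.
by rewrite -mulrA -ukb -kE.
Qed.

End CompletelyPrime.

(** * Pairs attached to an element g of P and an element t of Q *)

Section PrincipalCases.
Variables (R : pzRingType) (hR : uniserial R) (N : rmodType R).
Hypotheses (irrN : pp_irreducible N) (linkN : linked N).

Local Notation A := (annih N).
Local Notation P := (torsion N).
Local Notation Q := (nondiv N).

Variables (y0 : N) (t g : R).
Hypotheses (ty0 : ~ divides t y0) (y0g : y0 <* g = 0).

Let y0_neq0 : y0 <> 0.
Proof. by move=> y0E; apply: ty0; rewrite y0E; exact: div_zero. Qed.

Let Pg : P g. Proof. by exists y0. Qed.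

Let Qt : Q t. Proof. by exists y0. Qed.

Let cpP := torsion_completely_prime hR y0_neq0.
Let cpQ := nondiv_completely_prime hR y0_neq0.

Lemma right_Ib_kill (y : N) c : right_Ib P g c -> y <* g = 0 -> y <* c = 0.
Proof.
move=> Ic yg; apply: contrapT => yc; have [k gE] := ann_cmp hR yg yc.
apply: Ic; exists k => //; exists (y <* c) => //.
by rewrite -ractM -gE.
Qed.

Lemma left_Ib_ndiv (y : N) c : left_Ib Q t c -> ~ divides t y -> ~ divides c y.
Proof.
move=> Jc ty cy; have [k tE] := div_cmp hR ty cy.
case: cy => w wE; apply: Jc; exists k => //; exists w => kw.
by apply: ty; rewrite tE wE; exact: divMr.
Qed.

(** Factoring [t = q s] and [g = r p] makes finite satisfiability an instance of [fit]. In the other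
    direction the element [m t], nonzero because [m t g] is, is approximated in M. *)
Lemma realize_principal : ~ A (t * g) ->
  realized_alike N (right_Ib P g) (left_Ib Q t).
Proof.
move=> /existsNP [m mtg].
have g0 : g <> 0 by move=> g0; apply: mtg; rewrite g0 mulr0 ract0.
have t0 : t <> 0 by move=> t0; apply: mtg; rewrite t0 mul0r ract0.
apply: realize_alike => //.
- by case=> p _; rewrite mul0r.
- by case=> q _; rewrite mulr0.
- by apply; exists g; rewrite ?mul1r.
- by apply; exists t; rewrite ?mulr1.
- move=> s r t1 b1 /contrapT [q Qq tE] /contrapT [p Pp gE] Jt1 Ib1.
  have [||y [sy yr ty yg]] := fit hR irrN linkN (s := s) (r := r) _ Pp Qq.
  + by move=> Asr; apply: mtg; rewrite tE gE -mulrA (mulrA s) !ractM -(ractM _ s)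
      Asr ract0l.
  + by exists y0; rewrite -tE -gE.
  rewrite -tE in ty; rewrite -gE in yg.
  by exists y; split=> //; [exact: left_Ib_ndiv ty | exact: right_Ib_kill yg].
move=> M x irrM linkM xn0 IE JE; exists (m <* t).
  by move=> mt; apply: mtg; rewrite ractM mt ract0l.
apply: approx_of_covers => //.
(* A link between [y] and [y0] turns [y d <> 0] into a statement about I_g^P, which kills [y0] and
   is the annihilator of [x]. *)
- move=> d Ad y; apply: contrapT => yd.
  have [k [[kann kdiv]|[kann kdiv]]] := linkN y0_neq0 (ract_neq0 yd).
    apply: (yd); apply/kann; rewrite -ractM; apply: right_Ib_kill y0g.
    by apply/IE; rewrite ractM.
  have : ~ left_Ib Q t k.
    by move=> /left_Ib_ndiv /(_ ty0); apply; apply/kdiv; exists y.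
  move=> /JE/contrapT [y' y'E].
  case: (right_chain hR d k) => -[d' E].
    apply: yd; rewrite E ractM; apply/kann; apply: right_Ib_kill y0g.
    by apply/IE; rewrite y'E -ractM -E Ad.
  by apply: xn0; rewrite y'E E ractM Ad ract0l.
- move=> r /(right_Ib_sharp hR cpP Pg g0) [c nIc Icr].
  by exists (x <* c); [move/IE | rewrite -ractM; exact/IE].
- move=> s /(left_Ib_sharp hR cpQ Qt t0) [c nJc Jsc].
  have [y yE] : divides c x by apply: contrapT => /JE.
  by exists y => sy; move/JE: Jsc; apply; rewrite yE; exact: divMr.
(* [x] serves for every pair: [t = q t1] would make [t1] divide [m t], and [g = b1 p] would give
   [m t g = 0]. *)
- move=> t1 b1 t1u ub1; exists x; split.
    apply/JE => -[q Qq tE]; apply: t1u; exists (m <* q).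
    by rewrite tE ractM.
  apply/IE => -[p Pp gE]; apply: mtg.
  by rewrite ractM gE ractM ub1 ract0l.
Qed.

Hypothesis coverA : forall t' g', covers N t' g' -> A (t' * g').

Let satisfies_principal : (forall s, left_Ib Q t s \/ divides s y0) ->
    (forall r, y0 <* r = 0 -> right_Ib P g r) ->
  satisfies (right_Ib P g) (left_Ib Q t) y0.
Proof.
move=> hJ hI; split=> [s|r Ir|s r Js nIr]; first by case: (hJ s).
  exact: right_Ib_kill Ir y0g.
by move=> /irrN [|/hI //]; exact: left_Ib_ndiv ty0.
Qed.

(** If [y0] missed the pair through some [s] or [r], then [s g] or [t r] would annihilate N by
    [coverA]. Comparing [s] with [c], or [r] with [c0], then yields a factorization of [g] of the
    excluded kind. *)
Lemma principal_of_torsion :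
    (forall s, Q s -> exists2 c, ~ A c & A (s * c)) ->
    ~ (exists c, [/\ ~ A c, A (t * c) & exists2 p, P p & g = c * p]) ->
  [/\ t <> 0, g <> 0 & satisfies (right_Ib P g) (left_Ib Q t) y0].
Proof.
move=> hQ fail; have [[[A0 _] AR] [_ AL]] := annih_two_sided N.
have [[_ [_ PL]] _ _] := cpP.
have n1 := annih1 y0_neq0; have [c0 nc0 tc0] := hQ _ Qt.
split.
- move=> t0; apply: fail; exists 1; split; rewrite ?t0 ?mul0r //.
  by exists g; rewrite ?mul1r.
- move=> g0; apply: fail; exists c0; split=> //.
  by exists 0; [exists y0; rewrite ?ract0 | rewrite mulr0].
apply: satisfies_principal => [s|r y0r].
  apply: contrapT => /not_orP [/contrapT [q Qq tE] nsy0].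
  have Asg : A (s * g) by apply: coverA; exists y0.
  have [c nc Aqc] := hQ _ Qq.
  case: (right_chain hR c s) => -[k E].
    apply: fail; exists k; split; last 1 first.
    + case: (right_chain hR g k) => -[h hE]; last first.
        by case: nc; rewrite E hE mulrA; exact: AR.
      exists h => //; have /existsNP [m mc] := nc; exists (m <* c) => //.
      by rewrite E -ractM -mulrA -hE.
    + by move=> Ak; apply: nc; rewrite E; exact: AL.
    + by rewrite tE -mulrA -E.
  apply: fail; exists 1; split; rewrite ?mulr1 //.
    by rewrite tE E mulrA; exact: AR.
  by exists g; rewrite ?mul1r.
move=> [p Pp gE]; have Atr : A (t * r) by apply: coverA; exists y0.
have [Ar|nAr] := EM (A r); last first.
  by apply: fail; exists r; split=> //; exists p.
case: (right_chain hR r c0) => -[k E]; last by apply: nc0; rewrite E; exact: AR.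
apply: fail; exists c0; split=> //; exists (k * p); first exact: PL.
by rewrite mulrA -E.
Qed.

Lemma principal_of_nondiv :
    (forall r, P r -> exists2 c, ~ A c & A (c * r)) ->
    ~ (exists c, [/\ ~ A c, A (c * g) & exists2 q, Q q & t = q * c]) ->
  [/\ t <> 0, g <> 0 & satisfies (right_Ib P g) (left_Ib Q t) y0].
Proof.
move=> hP fail; have [[[A0 _] AR] [_ AL]] := annih_two_sided N.
have [[[_ QR] _] _ _] := cpQ.
have n1 := annih1 y0_neq0; have [c0 nc0 gc0] := hP _ Pg.
split.
- move=> t0; apply: fail; exists c0; split=> //.
  by exists 0; [exists y0; move/div0 | rewrite mul0r].
- move=> g0; apply: fail; exists 1; split; rewrite ?g0 ?mulr0 //.
  by exists t; rewrite ?mulr1.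
apply: satisfies_principal => [s|r y0r].
  apply: contrapT => /not_orP [/contrapT [q Qq tE] nsy0].
  have Asg : A (s * g) by apply: coverA; exists y0.
  have [As|nAs] := EM (A s); last first.
    by apply: fail; exists s; split=> //; exists q.
  case: (left_chain hR s c0) => -[k E]; last by apply: nc0; rewrite E; exact: AL.
  apply: fail; exists c0; split=> //; exists (q * k); first exact: QR.
  by rewrite -mulrA -E.
move=> [p Pp gE]; have Atr : A (t * r) by apply: coverA; exists y0.
have [c nc Acp] := hP _ Pp.
case: (left_chain hR c r) => -[k E].
  apply: fail; exists k; split; last 1 first.
  - case: (left_chain hR t k) => -[h hE]; last first.
      by case: nc; rewrite E hE -mulrA; exact: AL.
    exists h => //; have /existsNP [m mc] := nc; exists m => -[w wE].
    by apply: mc; rewrite wE E -ractM mulrA -hE Atr.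
  - by move=> Ak; apply: nc; rewrite E; exact: AR.
  - by rewrite gE mulrA -E.
apply: fail; exists 1; split; rewrite ?mul1r //.
  by rewrite gE E -mulrA; exact: AL.
by exists t; rewrite ?mulr1.
Qed.

End PrincipalCases.

(** * The two symmetric cases when every t g annihilates N *)

Section Dichotomy.
Variables (R : pzRingType) (hR : uniserial R) (N : rmodType R).
Hypotheses (irrN : pp_irreducible N) (linkN : linked N).

(** Let [s] and [r] violate the two alternatives, with [s] not dividing [y] and [w r = 0]. A link
    moves both facts to one element, so [s k r], or [s' r] with [s = s' k], annihilates N, against
    the choice of [s] and [r]. *)
Lemma annih_dichotomy x0 : x0 <> 0 :> N ->
    (forall t g, covers N t g -> annih N (t * g)) ->
  (forall s, nondiv N s -> exists2 c, ~ annih N c & annih N (s * c)) \/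
  (forall r, torsion N r -> exists2 c, ~ annih N c & annih N (c * r)).
Proof.
move=> x0_neq0 coverA; apply: contrapT => /not_orP [].
move=> /existsNP [s /not_implyP [[y sy] hs]] /existsNP [r /not_implyP [[w w0 wr] hr]].
have {}hs c : ~ annih N c -> ~ annih N (s * c) by move=> nc Ac; apply: hs; exists c.
have {}hr c : ~ annih N c -> ~ annih N (c * r) by move=> nc Ac; apply: hr; exists c.
have y0 : y <> 0 by move=> y0; apply: sy; rewrite y0; exact: div_zero.
have [k [[kann kdiv]|[kann kdiv]]] := linkN y0 w0.
  have yk : y <* k <> 0 by rewrite -[y <* k]ract1 => /kann; rewrite ract1.
  apply: (hs (k * r)); first by apply: hr => /(_ y).
  by apply: coverA; exists y; split=> //; rewrite ractM; exact/kann.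
have [s' sE] : exists s', s = s' * k.
  by apply: (div_cmp hR (x := w <* k)); [move/kdiv | exists w].
apply: (hr s').
  move=> As'; apply: (hs 1) => [/(_ x0)|x]; first by rewrite ract1.
  by rewrite mulr1 sE ractM As' ract0l.
by apply: coverA; exists w; split=> // s'w; apply/sy/kdiv; rewrite sE; exact: divMr.
Qed.

End Dichotomy.

(** * From realizing modules to points of the spectrum *)

Lemma realized_alike_point (R : pzRingType) (hR : uniserial R) (p : Zg R)
    (N : rmodType R) (I J : set R) :
    zg_class p = mod_iso N -> pp_irreducible N ->
    I 0 -> J 0 -> ~ I 1 -> ~ J 1 -> realized_alike N I J ->
  exists2 q : Zg R, indistinguishable p q & is_N I J q.
Proof.
move=> pN irrN I0 J0 I1 J1 [M [iM cM [x xIJ] MN NM]].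
have irrM := indecomposable_pp_irreducible hR iM cM.
have qP : exists M', [/\ indecomposable M', pure_injective M' & mod_iso M = mod_iso M'].
  by exists M; split=> //; exact: alg_compact_pure_injective.
exists (ZgPoint qP).
  apply: basic_indistinguishable => phi psi.
  rewrite (zg_basicE hR phi psi pN) (@zg_basicE _ hR phi psi (ZgPoint qP) M) //.
  by split; exact: approx_pp_pair_open.
split; first exact: satisfies_is_pair xIJ.
by exists M; [exists idfun; exists idfun | exists x].
Qed.

Theorem proposition3p10 (R : pzRingType) (hR : uniserial R) (p : Zg R) :
  exists2 q : Zg R, indistinguishable p q &
    [\/ exists P K : set R,
          [/\ two_sided_ideal K, is_proper K, completely_prime P,
              (forall r s : R, K (r * s) -> K r \/ P s) &
              is_N P K q],
        exists P K : set R,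
          [/\ two_sided_ideal K, is_proper K, completely_prime P,
              (forall r s : R, K (s * r) -> K r \/ P s) &
              is_N K P q] |
        exists (P Q : set R) (a b : R),
          [/\ [/\ completely_prime P, nonzero_ideal P,
                  completely_prime Q & nonzero_ideal Q],
              [/\ P b, b <> 0, Q a & a <> 0],
              consistent (right_Ib P b) (left_Ib Q a) &
              is_N (right_Ib P b) (left_Ib Q a) q]].
Proof.
have [N [iN piN pN]] := zg_classP p.
have cN := pure_injective_alg_compact piN.
have irrN := indecomposable_pp_irreducible hR iN cN.
have linkN := indecomposable_linked hR iN cN.
have [x0 x0_neq0] : exists x0 : N, x0 <> 0.
  by apply: contrapT => /forallNP nN; apply: iN.1 => x; exact: contrapT (nN x).
pose A := annih N; pose P := torsion N; pose Q := nondiv N.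
have cpP : completely_prime P := torsion_completely_prime hR x0_neq0.
have cpQ : completely_prime Q := nondiv_completely_prime hR x0_neq0.
have A1 : ~ A 1 := annih1 x0_neq0.
have Aproper : is_proper A by move=> AT; apply: A1; rewrite AT.
have P0 : P 0 by exists x0 => //; exact: ract0.
have Q0 : Q 0 by exists x0 => /div0.
have A0 : A 0 by move=> x; exact: ract0.
have AP r s : A (r * s) -> A r \/ P s.
  move=> Ars; have [Ar|/existsNP [m mr]] := EM (A r); first by left.
  by right; exists (m <* r) => //; rewrite -ractM Ars.
have AQ r s : A (s * r) -> A r \/ Q s.
  move=> Asr; have [Qs|nQs] := EM (Q s); [by right | left=> x].
  have [y ->] : divides s x by apply: contrapT => sx; apply: nQs; exists x.
  by rewrite -ractM Asr.
have nonzero (K : set R) c : K c -> c <> 0 -> nonzero_ideal K.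
  by move=> Kc c0 KE; apply: c0; rewrite KE in Kc.
have principal t g (q : Zg R) : P g -> Q t -> t <> 0 -> g <> 0 ->
    is_N (right_Ib P g) (left_Ib Q t) q ->
    exists (P Q : set R) (a b : R),
          [/\ [/\ completely_prime P, nonzero_ideal P,
                  completely_prime Q & nonzero_ideal Q],
              [/\ P b, b <> 0, Q a & a <> 0],
              consistent (right_Ib P b) (left_Ib Q a) &
              is_N (right_Ib P b) (left_Ib Q a) q].
  move=> Pg Qt t0 g0 qN; exists P, Q, t, g; split=> //.
    by split=> //; [exact: nonzero Pg g0 | exact: nonzero Qt t0].
  by have [pair [M _ [x xs]]] := qN; split=> //; exists M, x.
have I0 g : g <> 0 -> right_Ib P g 0 by move=> g0 [c _]; rewrite mul0r.
have J0 t : t <> 0 -> left_Ib Q t 0 by move=> t0 [c _]; rewrite mulr0.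
have I1 g : P g -> ~ right_Ib P g 1 by move=> Pg; apply; exists g; rewrite ?mul1r.
have J1 t : Q t -> ~ left_Ib Q t 1 by move=> Qt; apply; exists t; rewrite ?mulr1.
(* No new module is built here: an element of N already satisfies the pair, so [q] is [p]. *)
have itself (y : N) t g : ~ divides t y -> y <* g = 0 ->
    [/\ t <> 0, g <> 0 & satisfies (right_Ib P g) (left_Ib Q t) y] ->
    exists2 q : Zg R, indistinguishable p q & exists (P Q : set R) (a b : R),
          [/\ [/\ completely_prime P, nonzero_ideal P,
                  completely_prime Q & nonzero_ideal Q],
              [/\ P b, b <> 0, Q a & a <> 0],
              consistent (right_Ib P b) (left_Ib Q a) &
              is_N (right_Ib P b) (left_Ib Q a) q].
  move=> ty yg [t0 g0 yIJ].
  have Pg : P g by exists y => // y0; apply: ty; rewrite y0; exact: div_zero.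
  have Qt : Q t by exists y.
  exists p => //; apply: (principal t g p Pg Qt t0 g0); split.
    exact: (satisfies_is_pair hR (I0 g g0) (J0 t t0) (I1 g Pg) (J1 t Qt) yIJ).
  by exists N; [rewrite pN; exists idfun; exists idfun | exists y].
have [[t [g [[y [ty yg]] nA]]]|coverA] :=
    EM (exists t g, covers N t g /\ ~ A (t * g)).
  have Pg : P g by exists y => // y0; apply: ty; rewrite y0; exact: div_zero.
  have Qt : Q t by exists y.
  have t0 : t <> 0 by move=> t0; apply: nA; rewrite t0 mul0r.
  have g0 : g <> 0 by move=> g0; apply: nA; rewrite g0 mulr0.
  have ra := realize_principal hR irrN linkN ty yg nA.
  have [q pq qN] := realized_alike_point hR pN irrN (I0 g g0) (J0 t t0)
    (I1 g Pg) (J1 t Qt) ra.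
  by exists q => //; apply: Or33; exact: principal qN.
have {}coverA t g : covers N t g -> A (t * g).
  by move=> tg; apply: contrapT => nA; apply: coverA; exists t, g.
have [hQ|hP] := annih_dichotomy hR linkN x0_neq0 coverA.
  have [Z1|nZ1] := EM (forall t g, covers N t g ->
      exists c, [/\ ~ A c, A (t * c) & exists2 p, P p & g = c * p]).
    have ra := realize_torsion_annih hR irrN linkN x0_neq0 Z1.
    have [||||q pq qN] := realized_alike_point hR pN irrN _ _ _ _ ra => //.
      exact: torsion1.
    by exists q => //; apply: Or31; exists P, A; split=> //; exact: annih_two_sided.
  move: nZ1 => /existsNP [t /existsNP [g /not_implyP [[y [ty yg]] fail]]].
  have := principal_of_torsion hR irrN ty yg coverA hQ fail.
  by case/(itself _ _ _ ty yg)=> q pq qN; exists q => //; exact: Or33.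
have [Z2|nZ2] := EM (forall t g, covers N t g ->
    exists c, [/\ ~ A c, A (c * g) & exists2 q, Q q & t = q * c]).
  have ra := realize_annih_nondiv hR irrN linkN x0_neq0 Z2.
  have [||||q pq qN] := realized_alike_point hR pN irrN _ _ _ _ ra => //.
    exact: nondiv1.
  by exists q => //; apply: Or32; exists Q, A; split=> //; exact: annih_two_sided.
move: nZ2 => /existsNP [t /existsNP [g /not_implyP [[y [ty yg]] fail]]].
have := principal_of_nondiv hR irrN ty yg coverA hP fail.
by case/(itself _ _ _ ty yg)=> q pq qN; exists q => //; exact: Or33.
Qed.
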